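(* For every $n\ge 0$, $$\sum_{\sigma\in\mathfrak S_n} s^{\mathrm{exc}\,\sigma}\,t^{\mathrm{des}\,\sigma}\,q^{\mathrm{maj}\,\sigma}\,Y^{\mathrm{fix}\,\sigma}=A_n(s,t,q,Y),$$ where the polynomials $A_n(s,t,q,Y)$ are defined by the identity of formal power series $$\sum_{r\ge 0}t^r\,\frac{(1-qs)\,(u;q)_r\,(usq;q)_r}{\bigl((u;q)_r-sq\,(usq;q)_r\bigr)\,(uY;q)_{r+1}}=\sum_{n\ge 0}A_n(s,t,q,Y)\,\frac{u^n}{(t;q)_{n+1}}.$$
   Context: $(a;q)_0=1$ and $(a;q)_n=(1-a)(1-aq)\cdots(1-aq^{n-1})$ for $n\ge1$. $\mathfrak S_n$ is the symmetric group of permutations $\sigma=\sigma(1)\cdots\sigma(n)$ of $\{1,\dots,n\}$. Statistics: $\mathrm{exc}\,\sigma=\#\{i:1\le i\le n-1,\ \sigma(i)>i\}$; $\mathrm{des}\,\sigma=\#\{i:1\le i\le n-1,\ \sigma(i)>\sigma(i+1)\}$; $\mathrm{maj}\,\sigma=\sum i$ over $1\le i\le n-1$ with $\sigma(i)>\sigma(i+1)$; $\mathrm{fix}\,\sigma=\#\{i:\sigma(i)=i\}$. *)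

(* Defs.v *)
From HB Require Import structures.
From mathcomp Require Import all_boot all_order all_algebra all_fingroup.
From mathcomp Require Import boolp.
From mathcomp Require Import mpoly.

Set Implicit Arguments.
Unset Strict Implicit.
Unset Printing Implicit Defensive.

Import GRing.Theory.
Local Open Scope ring_scope.

(* Formal power series in n commuting variables over R, given by their
   coefficients on the monomials 'X_{1..n}. *)
Record mpseries (n : nat) (R : Type) := MPSeries { pscoef : 'X_{1..n} -> R }.

HB.instance Definition _ n (R : Type) := gen_eqMixin (mpseries n R).
HB.instance Definition _ n (R : Type) := gen_choiceMixin (mpseries n R).

Lemma mpseriesP n (R : Type) (f g : mpseries n R) :
  (forall m, pscoef f m = pscoef g m) -> f = g.
Proof. by case: f g => [f] [g] /= /funext ->. Qed.

Section Ring.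
Variables (n : nat) (R : comNzRingType).
Implicit Types (f g h : mpseries n R) (m k : 'X_{1..n}).

Definition ps_const (c : R) : mpseries n R :=
  MPSeries (fun m => if m == 0%MM then c else 0).
Definition ps_add f g : mpseries n R :=
  MPSeries (fun m => pscoef f m + pscoef g m).
Definition ps_opp f : mpseries n R := MPSeries (fun m => - pscoef f m).
Definition ps_mul f g : mpseries n R :=
  MPSeries (fun m => \sum_(k : 'X_{1..n < (mdeg m).+1} | (k <= m)%MM)
                       pscoef f k * pscoef g (m - k)%MM).

Fact ps_addA : associative ps_add.
Proof. by move=> f g h; apply: mpseriesP => m /=; rewrite addrA. Qed.
Fact ps_addC : commutative ps_add.
Proof. by move=> f g; apply: mpseriesP => m /=; rewrite addrC. Qed.
Fact ps_add0 : left_id (ps_const 0) ps_add.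
Proof. by move=> f; apply: mpseriesP => m /=; rewrite if_same add0r. Qed.
Fact ps_addN : left_inverse (ps_const 0) ps_opp ps_add.
Proof. by move=> f; apply: mpseriesP => m /=; rewrite if_same addNr. Qed.

HB.instance Definition _ :=
  GRing.isZmodule.Build (mpseries n R) ps_addA ps_addC ps_add0 ps_addN.

(* The ring laws are transported from polynomials by truncation in degree. *)
Definition ps_trunc d f : {mpoly R[n]} :=
  \sum_(m : 'X_{1..n < d}) pscoef f m *: 'X_[m].

Lemma ps_truncE d f m : (mdeg m < d)%N -> (ps_trunc d f)@_m = pscoef f m.
Proof. exact: mcoeff_mpoly. Qed.

Lemma mcoeffM_lin d (p q : {mpoly R[n]}) m : (mdeg m < d)%N ->
  (p * q)@_m = \sum_(k : 'X_{1..n < d} | (k <= m)%MM) p@_k * q@_(m - k).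
Proof. exact: mcoeff_poly_mul_lin. Qed.

Lemma eq_mcoeffM d (p q p' q' : {mpoly R[n]}) m : (mdeg m < d)%N ->
  (forall k, (mdeg k < d)%N -> p@_k = p'@_k) ->
  (forall k, (mdeg k < d)%N -> q@_k = q'@_k) -> (p * q)@_m = (p' * q')@_m.
Proof.
move=> md pp qq; rewrite !(mcoeffM_lin _ _ md).
apply: eq_bigr => k _; rewrite pp ?bmdeg // qq //.
exact: leq_ltn_trans (mdegB _ _) md.
Qed.

Lemma ps_mulE d f g m : (mdeg m < d)%N ->
  pscoef (ps_mul f g) m = (ps_trunc d f * ps_trunc d g)@_m.
Proof.
move=> md; rewrite (@eq_mcoeffM (mdeg m).+1 _ _ (ps_trunc (mdeg m).+1 f)
   (ps_trunc (mdeg m).+1 g)) //.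
- rewrite (mcoeffM_lin _ _ (ltnSn _)) /=; apply: eq_bigr => k _.
  by rewrite !ps_truncE ?bmdeg // ltnS mdegB.
- by move=> k km; rewrite !ps_truncE // (leq_trans km).
- by move=> k km; rewrite !ps_truncE // (leq_trans km).
Qed.

Lemma ps_truncM d f g k : (mdeg k < d)%N ->
  (ps_trunc d (ps_mul f g))@_k = (ps_trunc d f * ps_trunc d g)@_k.
Proof. by move=> kd; rewrite ps_truncE // (ps_mulE _ _ kd). Qed.

Lemma ps_trunc_const d c k : (mdeg k < d)%N ->
  (ps_trunc d (ps_const c))@_k = (c%:MP : {mpoly R[n]})@_k.
Proof.
by move=> kd; rewrite ps_truncE // mcoeffC /=; case: eqP => _; rewrite ?mulr1 ?mulr0.
Qed.

Fact ps_mulA : associative ps_mul.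
Proof.
move=> f g h; apply: mpseriesP => m; have md := ltnSn (mdeg m).
rewrite !(ps_mulE _ _ md).
rewrite (eq_mcoeffM md (fun _ _ => erefl) (fun k => @ps_truncM _ g h k)) mulrA.
by rewrite -(eq_mcoeffM md (fun k => @ps_truncM _ f g k) (fun _ _ => erefl)).
Qed.

Fact ps_mulC : commutative ps_mul.
Proof.
move=> f g; apply: mpseriesP => m; have md := ltnSn (mdeg m).
by rewrite !(ps_mulE _ _ md) mulrC.
Qed.

Fact ps_mul1 : left_id (ps_const 1) ps_mul.
Proof.
move=> f; apply: mpseriesP => m; have md := ltnSn (mdeg m).
rewrite (ps_mulE _ _ md).
rewrite (eq_mcoeffM md (fun k => @ps_trunc_const _ 1 k) (fun _ _ => erefl)).
by rewrite mul1r ps_truncE.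
Qed.

Fact ps_mulDl : left_distributive ps_mul (@GRing.add (mpseries n R)).
Proof.
move=> f g h; apply: mpseriesP => m /=; rewrite -big_split /=.
by apply: eq_bigr => k _; rewrite mulrDl.
Qed.

Fact ps_one_neq0 : ps_const 1 != 0 :> mpseries n R.
Proof.
apply/eqP => /(congr1 (fun f => pscoef f 0%MM)) /= /eqP.
by rewrite eqxx (negbTE (oner_neq0 _)).
Qed.

HB.instance Definition _ := GRing.Zmodule_isComNzRing.Build (mpseries n R)
  ps_mulA ps_mulC ps_mul1 ps_mulDl ps_one_neq0.

Definition psX (i : 'I_n) : mpseries n R :=
  MPSeries (fun m => (m == U_(i)%MM)%:R).

Lemma pscoefD f g m : pscoef (f + g) m = pscoef f m + pscoef g m.
Proof. by []. Qed.
Lemma pscoefN f m : pscoef (- f) m = - pscoef f m.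
Proof. by []. Qed.
Lemma pscoef1 m : pscoef (1 : mpseries n R) m = (m == 0%MM)%:R.
Proof. by rewrite /= ; case: eqP. Qed.
Lemma pscoefM f g m : pscoef (f * g) m =
  \sum_(k : 'X_{1..n < (mdeg m).+1} | (k <= m)%MM)
     pscoef f k * pscoef g (m - k)%MM.
Proof. by []. Qed.

Definition ps_coef0 f : R := pscoef f 0%MM.

Fact ps_coef0_additive : zmod_morphism ps_coef0.
Proof. by []. Qed.
Fact ps_coef0_multiplicative : monoid_morphism ps_coef0.
Proof.
split=> [|f g]; first by rewrite /ps_coef0 pscoef1 eqxx.
rewrite /ps_coef0 [pscoef _ _](@ps_mulE 1) ?mdeg0 // rmorphM /=.
by rewrite !ps_truncE ?mdeg0.
Qed.

HB.instance Definition _ :=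
  GRing.isZmodMorphism.Build _ _ ps_coef0 ps_coef0_additive.
HB.instance Definition _ :=
  GRing.isMonoidMorphism.Build _ _ ps_coef0 ps_coef0_multiplicative.

Lemma ps_coef0_1 : ps_coef0 1 = 1. Proof. exact: rmorph1. Qed.
Lemma ps_coef0B f g : ps_coef0 (f - g) = ps_coef0 f - ps_coef0 g.
Proof. exact: rmorphB. Qed.
Lemma ps_coef0M f g : ps_coef0 (f * g) = ps_coef0 f * ps_coef0 g.
Proof. exact: rmorphM. Qed.

Lemma ps_coef0X i : ps_coef0 (psX i) = 0.
Proof. by rewrite /ps_coef0 /= eq_sym mnm1_eq0. Qed.

(* Convergence of a series of formal power series: every coefficient of the
   partial sums is eventually constant. *)
Definition ps_sums (F : nat -> mpseries n R) (S : mpseries n R) : Prop :=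
  forall m, exists N, forall j, (N <= j)%N ->
    pscoef (\sum_(r < j) F r) m = pscoef S m.

End Ring.

(* A power series is invertible iff its constant coefficient c is; the inverse
   g of f satisfies g_0 = c^-1 and g_m = - c^-1 \sum_(0 != k <= m) f_k g_(m-k).
   As everywhere in MathComp, the inverse of a non-unit is the non-unit itself. *)
Section Inverse.
Variables (n : nat) (R : comUnitRingType).
Implicit Types f g : mpseries n R.

Fixpoint ps_invrec f (d : nat) : 'X_{1..n} -> R :=
  if d isn't d'.+1 then fun=> 0 else fun m =>
  if m == 0%MM then (ps_coef0 f)^-1
  else - (ps_coef0 f)^-1 *
       \sum_(k : 'X_{1..n < (mdeg m).+1} | (k <= m)%MM && (k != 0%MM :> 'X_{1..n}))
          pscoef f k * ps_invrec f d' (m - k)%MM.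

Definition ps_unit : pred (mpseries n R) :=
  fun f => ps_coef0 f \is a GRing.unit.
Definition ps_inv f : mpseries n R :=
  if ps_unit f then MPSeries (fun m => ps_invrec f (mdeg m).+1 m) else f.

Lemma mdegB_lt (m k : 'X_{1..n}) :
  (k <= m)%MM -> k != 0%MM -> (mdeg (m - k) < mdeg m)%N.
Proof.
move=> km k0; rewrite -[X in (_ < mdeg X)%N](submK km) mdegD.
by rewrite -[X in (X < _)%N]addn0 ltn_add2l lt0n mdeg_eq0.
Qed.

Lemma ps_invrec_stable f d m :
  (mdeg m < d)%N -> ps_invrec f d m = ps_invrec f (mdeg m).+1 m.
Proof.
suff H d1 d2 m' : (mdeg m' < d1)%N -> (mdeg m' < d2)%N ->
    ps_invrec f d1 m' = ps_invrec f d2 m' by move=> md; apply: H.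
elim: d1 d2 m' => // d1 IH [//|d2] m' m1 m2 /=; case: eqP => // _.
congr (_ * _); apply: eq_bigr => k /andP [km k0]; congr (_ * _).
have lt_k := mdegB_lt km k0.
by apply: IH; apply: leq_trans lt_k _; rewrite -ltnS.
Qed.

Fact ps_mulVx : {in ps_unit, left_inverse 1 ps_inv *%R}.
Proof.
move=> f fu; have uf : ps_unit f := fu; rewrite mulrC; apply: mpseriesP => m.
rewrite /ps_inv uf pscoef1; set g := MPSeries _.
have g0 : pscoef g 0%MM = (ps_coef0 f)^-1 by rewrite /= eqxx.
case: eqVneq => [->|m0].
  rewrite -[LHS]/(ps_coef0 (f * g)) rmorphM.
  by rewrite -[X in _ * X]/(pscoef g 0%MM) g0; apply: divrr.
rewrite pscoefM.
have m0P : (mdeg (0%MM : 'X_{1..n}) < (mdeg m).+1)%N by rewrite mdeg0.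
rewrite (bigD1 (BMultinom m0P)) /=; last by apply/mnm_lepP => i; rewrite mnm0E.
rewrite subm0 (negbTE m0) mulrA mulrN divrr // mulN1r addrC.
apply/eqP; rewrite subr_eq0; apply/eqP.
apply: eq_big => [k|k /andP[km]]; first by rewrite bmeqP.
rewrite bmeqP => k0; congr (_ * _).
exact/esym/(ps_invrec_stable f (mdegB_lt km k0)).
Qed.

Fact ps_unitPl f g : g * f = 1 -> ps_unit f.
Proof.
move=> /(congr1 (@ps_coef0 n R)); rewrite rmorphM rmorph1 => gf.
by apply/unitrPr; exists (ps_coef0 g); rewrite mulrC.
Qed.

Fact ps_inv_out : {in [predC ps_unit], ps_inv =1 id}.
Proof. by move=> f fu; have nf : ~~ ps_unit f := fu; rewrite /ps_inv (negbTE nf). Qed.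

HB.instance Definition _ := GRing.ComNzRing_hasMulInverse.Build (mpseries n R)
  ps_mulVx ps_unitPl ps_inv_out.

Lemma ps_unitE f : (f \is a GRing.unit) = (ps_coef0 f \is a GRing.unit).
Proof. by []. Qed.

End Inverse.

Definition qpoch (R : pzRingType) (a q : R) (n : nat) : R :=
  \prod_(i < n) (1 - a * q ^+ i).

(* Permutations act on 'I_n = {0, .., n-1}: position i : 'I_n stands for i+1. *)
Section Statistics.
Variables (n : nat) (sigma : 'S_n).

Definition excedances : {set 'I_n} :=
  [set i : 'I_n | (i.+1 < n)%N && (i < sigma i)%N].
Definition descents : {set 'I_n} :=
  [set i : 'I_n | [exists j : 'I_n, (j == i.+1 :> nat) && (sigma j < sigma i)%N]].

Definition exc : nat := #|excedances|.
Definition des : nat := #|descents|.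
Definition maj : nat := (\sum_(i in descents) i.+1)%N.
Definition fix_ : nat := #|[set i : 'I_n | sigma i == i]|.

End Statistics.

Definition s_ : {mpoly int[4]} := 'X_(@Ordinal 4 0 isT).
Definition t_ : {mpoly int[4]} := 'X_(@Ordinal 4 1 isT).
Definition q_ : {mpoly int[4]} := 'X_(@Ordinal 4 2 isT).
Definition Y_ : {mpoly int[4]} := 'X_(@Ordinal 4 3 isT).

Definition Zps := mpseries 5 int.
Definition ps_s : Zps := psX int (@Ordinal 5 0 isT).
Definition ps_t : Zps := psX int (@Ordinal 5 1 isT).
Definition ps_q : Zps := psX int (@Ordinal 5 2 isT).
Definition ps_Y : Zps := psX int (@Ordinal 5 3 isT).
Definition ps_u : Zps := psX int (@Ordinal 5 4 isT).

(* The inclusion of Z[s,t,q,Y] into Z[[s,t,q,Y,u]]. *)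
Definition ps_of_mpoly : {mpoly int[4]} -> Zps :=
  mmap intr (fun i : 'I_4 => [:: ps_s; ps_t; ps_q; ps_Y]`_i).

Definition lhs_den (r : nat) : Zps :=
  (qpoch ps_u ps_q r - ps_s * ps_q * qpoch (ps_u * ps_s * ps_q) ps_q r)
  * qpoch (ps_u * ps_Y) ps_q r.+1.

Definition lhs_term (r : nat) : Zps :=
  ps_t ^+ r *
  ((1 - ps_q * ps_s) * qpoch ps_u ps_q r * qpoch (ps_u * ps_s * ps_q) ps_q r
   / lhs_den r).

Definition rhs_term (A : nat -> {mpoly int[4]}) (n : nat) : Zps :=
  ps_of_mpoly (A n) * (ps_u ^+ n / qpoch ps_t ps_q n.+1).

(* Both series converge in Z[[s,t,q,Y,u]], to the same sum. *)
Definition defining_identity (A : nat -> {mpoly int[4]}) : Prop :=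
  exists2 S : Zps, ps_sums lhs_term S & ps_sums (rhs_term A) S.

(* All denominators have constant coefficient 1, so the quotients above are
   genuine ones. *)
Lemma ps_coef0_qpoch (a q : Zps) r :
  ps_coef0 a = 0 -> ps_coef0 (qpoch a q r) = 1.
Proof.
move=> a0; rewrite [LHS]rmorph_prod big1 // => i _.
by rewrite [LHS]ps_coef0B ps_coef0_1 ps_coef0M a0 mul0r subr0.
Qed.

Lemma lhs_den_unit r : lhs_den r \is a GRing.unit.
Proof.
have u0 : ps_coef0 ps_u = 0 by apply: ps_coef0X.
have s0 : ps_coef0 ps_s = 0 by apply: ps_coef0X.
rewrite ps_unitE /lhs_den ps_coef0M ps_coef0B !ps_coef0M s0.
by rewrite !ps_coef0_qpoch ?ps_coef0M ?u0 ?mul0r // subr0 mulr1 unitr1.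
Qed.

Lemma rhs_den_unit r : qpoch ps_t ps_q r \is a GRing.unit.
Proof. by rewrite ps_unitE ps_coef0_qpoch ?unitr1 ?ps_coef0X. Qed.

(* Main.v *)
(* Expanding t^des q^maj / (t;q)_{n+1} by MacMahon's Verfahren, the theorem says
   that for each r the pairs (sigma, b), with b : [n] -> [0, r] nonincreasing and
   strictly decreasing at the descents of sigma, weighted by
   q^|b| s^exc Y^fix u^n, have the r-th fraction of the left-hand side as their
   generating function.

   On each level set of b the permutation is increasing, so sigma(i) - i is
   nondecreasing there: the level set splits into anti-excedances, fixed points
   and excedances, in that order. Reading the labels (b_i, sign (sigma(i) - i)) in
   the order of sigma^-1 turns (sigma, b) into a word, and standardization inverts
   this; the words that occur are described position by position, as in
   MacMahon's Master Theorem: position j of a word v compares the letter v_j with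
   the j-th letter of the sorted word.

   Their generating function is a sum of diagonal coefficients of products of
   powers of linear forms. It is computed by eliminating the letters one by one;
   because of the shape of the forms the state of the elimination is a single
   scalar lam, and rho = 1 / (1 + lam) undergoes rho -> rho (1 - u q^c) for an
   anti-excedance letter of colour c and rho -> (rho - w) / (1 - w), w = s u q^c,
   for an excedance letter. This recursion is solved by
   rho = ((u;q)_c - s q (usq;q)_c) / ((1 - q s) (usq;q)_c). *)
From HB Require Import structures.
Require Import Defs.
From mathcomp Require Import all_boot all_order all_algebra all_fingroup.
From mathcomp Require Import mpoly qpoly ring zify.

Set Implicit Arguments.
Unset Strict Implicit.
Unset Printing Implicit Defensive.

Import GRing.Theory.
Local Open Scope ring_scope.

(** * Finite functions split at their last or first value *)

Section FfunSplit.
Variables (T : finType) (n : nat).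

Definition ffrcons (f : {ffun 'I_n -> T}) (x : T) : {ffun 'I_n.+1 -> T} :=
  [ffun i => if unlift ord_max i is Some j then f j else x].

Definition ffcons (x : T) (f : {ffun 'I_n -> T}) : {ffun 'I_n.+1 -> T} :=
  [ffun i => if unlift ord0 i is Some j then f j else x].

Lemma ffrcons_max f x : ffrcons f x ord_max = x.
Proof. by rewrite ffunE unlift_none. Qed.

Lemma ffrcons_lift f x i : ffrcons f x (widen_ord (leqnSn n) i) = f i.
Proof.
have -> : widen_ord (leqnSn n) i = lift ord_max i.
  by apply: val_inj; rewrite /= /bump leqNgt ltn_ord.
by rewrite ffunE liftK.
Qed.

Lemma ffcons0 x f : ffcons x f ord0 = x.
Proof. by rewrite ffunE unlift_none. Qed.

Lemma ffconsS x f i : ffcons x f (lift ord0 i) = f i.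
Proof. by rewrite ffunE liftK. Qed.

Lemma big_ffrcons (R : Type) (idx : R) (op : Monoid.com_law idx)
    (F : {ffun 'I_n.+1 -> T} -> R) :
  \big[op/idx]_f F f =
  \big[op/idx]_(f : {ffun 'I_n -> T}) \big[op/idx]_x F (ffrcons f x).
Proof.
rewrite pair_bigA /= (reindex (fun p => ffrcons p.1 p.2)) //=.
exists (fun f => ([ffun i => f (lift ord_max i)], f ord_max)).
  case=> f x _ /=; congr pair; last by rewrite ffrcons_max.
  by apply/ffunP=> i; rewrite !ffunE liftK.
move=> f _ /=; apply/ffunP=> i; rewrite ffunE.
by case: unliftP => [j ->|->]; rewrite ?ffunE.
Qed.

Lemma big_ffcons (R : Type) (idx : R) (op : Monoid.com_law idx)
    (F : {ffun 'I_n.+1 -> T} -> R) :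
  \big[op/idx]_f F f =
  \big[op/idx]_x \big[op/idx]_(f : {ffun 'I_n -> T}) F (ffcons x f).
Proof.
rewrite pair_bigA /= (reindex (fun p => ffcons p.1 p.2)) //=.
exists (fun f => (f ord0, [ffun i => f (lift ord0 i)])).
  case=> x f _ /=; congr pair; first by rewrite ffcons0.
  by apply/ffunP=> i; rewrite !ffunE liftK.
move=> f _ /=; apply/ffunP=> i; rewrite ffunE.
by case: unliftP => [j ->|->]; rewrite ?ffunE.
Qed.

End FfunSplit.

(** * Diagonal coefficients of products of linear forms *)

Section LinearForms.
Variable R : comNzRingType.

Definition lin K (c : nat -> R) : {mpoly R[K]} := \sum_(a < K) c a *: 'X_a.

Lemma eq_lin K (c c' : nat -> R) :
  (forall a, (a < K)%N -> c a = c' a) -> lin K c = lin K c'.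
Proof. by move=> cc; apply: eq_bigr => a _; rewrite cc. Qed.

Lemma linD K c c' : lin K (fun a => c a + c' a) = lin K c + lin K c'.
Proof. by rewrite -big_split; apply: eq_bigr => a _; rewrite scalerDl. Qed.

Lemma linZ K k c : lin K (fun a => k * c a) = k *: lin K c.
Proof. by rewrite scaler_sumr; apply: eq_bigr => a _; rewrite scalerA. Qed.

Lemma muniXw K (i : 'I_K) :
  muni ('X_(widen_ord (leqnSn K) i) : {mpoly R[K.+1]}) = ('X_i)%:P.
Proof.
rewrite muniE msuppX big_seq1 mcoeffX eqxx scale1r.
rewrite mnm1E -val_eqE /= ltn_eqF ?ltn_ord // expr0 alg_polyC; congr (_ %:P).
congr 'X_[_]; apply/mnmP=> j; rewrite mnmE !mnm1E.
by rewrite -val_eqE.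
Qed.

Lemma muniXmax K : muni ('X_ord_max : {mpoly R[K.+1]}) = 'X.
Proof.
rewrite muniE msuppX big_seq1 mcoeffX eqxx scale1r mnm1E eqxx expr1.
rewrite (_ : [multinom _ | _ < _] = 0%MM) ?mpolyX0 ?scale1r //.
by apply/mnmP=> j; rewrite mnmE mnm1E mnm0E -val_eqE /= gtn_eqF ?ltn_ord.
Qed.

Lemma muni_lin K c : muni (lin K.+1 c) = (lin K c)%:P + (c K)%:MP *: 'X.
Proof.
rewrite /lin raddf_sum big_ord_recr /= muniZ muniXmax; congr (_ + _).
rewrite raddf_sum /=; apply: eq_bigr => a _.
by rewrite muniZ muniXw -mul_polyC -polyCM mul_mpolyC.
Qed.

(** [muni] singles out the last variable, so a coefficient is extracted in two stages; this lets
    variables be eliminated one at a time. *)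
Lemma mcoeff_muni K (p : {mpoly R[K.+1]}) (m : 'X_{1..K}) (m' : 'X_{1..K.+1}) :
  (forall i, m' (widen_ord (leqnSn K) i) = m i) ->
  p@_m' = ((muni p)`_(m' ord_max))@_m.
Proof.
move=> mm'; rewrite muniE coef_sum raddf_sum /=.
rewrite {1}(mpolyE p) raddf_sum /=; apply: eq_bigr => m1 _.
rewrite mcoeffZ coefZ coefXn mcoeffX.
have -> : (m1 == m') = ((m1 ord_max == m' ord_max) &&
    ([multinom m1 (widen_ord (leqnSn K) i) | i < K] == m)).
  apply/eqP/andP=> [->|[/eqP e1 /eqP e2]].
    by split=> //; apply/eqP/mnmP=> i; rewrite mnmE mm'.
  apply/mnmP=> i; case: (unliftP ord_max i) => [j ->|-> //].
  have -> : lift ord_max j = widen_ord (leqnSn K) j.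
    by apply: val_inj; rewrite /= /bump leqNgt ltn_ord.
  by rewrite mm' -e2 mnmE.
rewrite eq_sym; case: eqP => _ /=; rewrite ?mulr1 ?mulr0 ?mcoeff0 //.
by rewrite mcoeffZ mcoeffX.
Qed.

End LinearForms.

(* Gaussian elimination of one variable: extracting the diagonal coefficients
   of [(a 'X + l) ^+ k * P] amounts to solving ['X = a 'X + l]. *)
Section Elimination.
Variables (S : comNzRingType) (B : nat) (a l h g : S).
Let L : {poly S} := a *: 'X + l%:P.
Hypotheses (LB : L ^+ B = 0) (hB : forall k, (k.+1 = B)%N -> h *: L ^+ k = 0).
Hypothesis (ag : (1 - a) * g = 1).

Let diag (P : {poly S}) := \sum_(k < B) (L ^+ k * P)`_k.

(** Multiplication by ['X] shifts the coefficient index, so [diag ('X * P) = diag (L * P)], the term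
    beyond the range vanishing by [LB]. Expanding [L] gives a linear equation, solved by the inverse
    [g] of [1 - a]. *)
Let diagM (P : {poly S}) : diag ('X * P) = g * l * diag P.
Proof.
suff H : diag ('X * P) = a * diag ('X * P) + l * diag P.
  rewrite -[LHS]mul1r -ag mulrAC mulrBl mul1r {1}H addrAC subrr add0r.
  by rewrite mulrC mulrA.
have -> : a * diag ('X * P) + l * diag P = \sum_(k < B) (L ^+ k.+1 * P)`_k.
  rewrite !mulr_sumr -big_split /=; apply: eq_bigr => k _.
  rewrite -!coefZ -coefD; congr (polyseq _)`_k.
  by rewrite exprS /L -!mul_polyC; ring.
rewrite /diag; case: B LB => [|b] Lb; first by rewrite !big_ord0.
rewrite big_ord_recl big_ord_recr /= Lb mul0r coef0 addr0.
rewrite expr0 mul1r coefXM eqxx add0r; apply: eq_bigr => k _.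
by rewrite mulrCA coefXM.
Qed.

(** [diag] is linear and, by [diagM], turns a factor ['X] into the scalar [g * l]; up to [diag 1] it
    is evaluation there. *)
Let diagE (P : {poly S}) : diag P = diag 1 * P.[g * l].
Proof.
elim/poly_ind: P => [|P c IH].
  by rewrite horner0 mulr0 /diag big1 // => k _; rewrite mulr0 coef0.
have -> : diag (P * 'X + c%:P) = diag ('X * P) + c * diag 1.
  rewrite /diag mulr_sumr -big_split; apply: eq_bigr => k _.
  rewrite /= -[X in _ = _ + X]coefZ -coefD -mul_polyC; congr (polyseq _)`_k.
  by rewrite mulr1 mulrDr (mulrC P) [_ * c%:P]mulrC.
rewrite diagM IH hornerMXaddC; move: (diag 1) => D; ring.
Qed.

(** [L ^+ k] has degree at most [k], with coefficient [a ^+ k] there, so this is a geometric sum;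
    [LB] also yields [a ^+ B = 0]. *)
Let diag1 : (1 <= B)%N -> diag 1 = g.
Proof.
move=> B0; have LE k : (L ^+ k)`_k = a ^+ k.
  have szL m : (size (L ^+ m) <= m.+1)%N.
    elim: m => [|m IHm]; first by rewrite expr0 size_poly1.
    rewrite exprS; apply: leq_trans (size_polyMleq _ _) _.
    have : (size L <= 2)%N.
      apply: leq_trans (size_polyD _ _) _; rewrite geq_max.
      apply/andP; split; last by apply: leq_trans (size_polyC_leq1 _) _.
      by apply: leq_trans (size_scale_leq _ _) _; rewrite size_polyX.
    lia.
  elim: k => [|k IH]; first by rewrite expr0 coef1.
  rewrite !exprS -IH -[L in L * _]/(a *: 'X + l%:P) mulrDl coefD -scalerAl coefZ.
  rewrite coefXM /= coefCM [X in _ + _ * X]nth_default ?szL //.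
  by rewrite mulr0 addr0.
have -> : diag 1 = \sum_(k < B) a ^+ k.
  by apply: eq_bigr => k _; rewrite mulr1 LE.
rewrite -[LHS]mulr1 -ag mulrA; have := subrX1 a B.
rewrite -[a - 1]opprB mulNr -LE LB coef0 sub0r => /oppr_inj e.
by rewrite [X in X * g]mulrC -e mul1r.
Qed.

Lemma diag_elim (P : {poly S}) : (1 <= B)%N ->
  \sum_(k < B) ((if (k : nat) is k'.+1 then L ^+ k' * (L - h *: 'X) else 1)
                 * P)`_k
  = (1 - h) * g * P.[g * l].
Proof.
move=> B0; rewrite -[RHS]mulrA -{1}(diag1 B0) -diagE.
suff -> : \sum_(k < B) ((if (k : nat) is k'.+1 then L ^+ k' * (L - h *: 'X)
    else 1) * P)`_k = diag P - h * diag P by ring.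
rewrite /diag; case: B B0 hB => // b _ hb.
(* The subtracted sum lacks only the top index of [diag P], and [hB] kills that term. *)
rewrite [in X in _ = _ - h * X]big_ord_recr !big_ord_recl /= mulrDr.
rewrite -[in X in _ = _ - (_ + X)]coefZ scalerAl hb // mul0r coef0 addr0.
rewrite -[RHS]addrA; congr (_ + _); rewrite mulr_sumr -sumrB; apply: eq_bigr => k _.
rewrite /bump /= add1n mulrBr mulrBl coefB -exprSr; congr (_ - _).
by rewrite -scalerAr -!scalerAl coefZ mulrAC coefMX.
Qed.

End Elimination.

(** * Block sums and elimination of the last letter *)

Section BlockSum.
Variables (R : comNzRingType) (u : R) (B : nat).
Hypotheses (uB : u ^+ B = 0) (B0 : (0 < B)%N).

(** The product of the forms at the [k] positions of block [i] of the sorted word; one end position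
    has [h i] taken off its diagonal coefficient. *)
Definition block K (M : nat -> nat -> R) (h : nat -> R) (i k : nat) :
    {mpoly R[K]} :=
  if k is k'.+1 then
    lin K (M i) ^+ k' * lin K (fun a => M i a - (if a == i then h i else 0))
  else 1.

(** The sum of diagonal coefficients in MacMahon's Master Theorem, with multiplicities cut off below
    [B]. *)
Definition block_sum K (M : nat -> nat -> R) (h : nat -> R) : R :=
  \sum_(m : {ffun 'I_K -> 'I_B})
    (\prod_(i < K) block K M h i (m i))@_[multinom (m i : nat) | i < K].

Lemma eq_block_sum K (M M' : nat -> nat -> R) h :
  (forall i a, (i < K)%N -> (a < K)%N -> M i a = M' i a) ->
  block_sum K M h = block_sum K M' h.
Proof.
move=> MM'; apply: eq_bigr => m _; congr (mcoeff _); apply: eq_bigr => i _.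
rewrite /block; case: (m i : nat) => // k.
rewrite (@eq_lin _ _ (M i) (M' i)) => [|a aK]; last by rewrite MM'.
by congr (_ * _); apply: eq_lin => a aK; rewrite MM'.
Qed.

Lemma block_sum0 M h : block_sum 0 M h = 1.
Proof.
rewrite /block_sum (eq_bigr (fun=> 1)) => [|m _].
  by rewrite sumr_const card_ffun !card_ord expn0.
rewrite big_ord0 mcoeff1; suff -> : [multinom (m i : nat) | i < 0] = 0%MM by rewrite eqxx.
by apply/mnmP => -[].
Qed.

(** [diag_elim] substitutes [g * lin K (M K)] for the last variable, which turns the matrix [1 - M]
    into a Schur complement. [Mu] and [hu] provide the nilpotency it requires. *)
Lemma block_sum_elim K (M M1 : nat -> nat -> R) (h h1 : nat -> R) (g : R) :
  (forall i a, M i a = u * M1 i a) -> (forall i, h i = u * h1 i) ->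
  (1 - M K K) * g = 1 ->
  block_sum K.+1 M h =
  (1 - h K) * g * block_sum K (fun i a => M i a + M i K * g * M K a) h.
Proof.
move=> Mu hu gK; rewrite /block_sum big_ffrcons mulr_sumr.
apply: eq_bigr => m _; set mm := [multinom _ | _ < K].
pose L : {poly {mpoly R[K]}} := (M K K)%:MP *: 'X + (lin K (M K))%:P.
pose P := \prod_(i < K) muni (block K.+1 M h i (m i)).
transitivity ((\sum_(k < B) ((if (k : nat) is k'.+1 then
    L ^+ k' * (L - (h K)%:MP *: 'X) else 1) * P)`_k)@_mm).
  rewrite raddf_sum /=; apply: eq_bigr => x _.
  rewrite (@mcoeff_muni _ _ _ mm) => [|i]; last by rewrite !mnmE ffrcons_lift.
  rewrite mnmE ffrcons_max big_ord_recr /= ffrcons_max muniM mulrC.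
  congr (mcoeff _ (polyseq (_ * _))`_x); last first.
    rewrite /P rmorph_prod /=; apply: eq_bigr => i _.
    by rewrite ffrcons_lift.
  rewrite /block; case: (x : nat) => [|k]; first by rewrite muni1.
  rewrite muniM rmorphXn /= !muni_lin eqxx /L [_%:P + _]addrC.
  congr (_ * _); rewrite (@eq_lin _ _ _ (M K)) => [|a aK]; last first.
    by rewrite ltn_eqF // subr0.
  by rewrite mpolyCB scalerBl addrC addrAC.
have [c Lc] : exists c, L = (u%:MP)%:P * c.
  have e : lin K (M K) = u%:MP * lin K (M1 K).
    by rewrite mul_mpolyC -linZ; apply: eq_lin => a _; rewrite Mu.
  exists ((M1 K K)%:MP *: 'X + (lin K (M1 K))%:P); rewrite /L e Mu mpolyCM.
  by rewrite -!mul_polyC !polyCM; ring.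
have uu : ((u%:MP)%:P : {poly {mpoly R[K]}}) ^+ B = 0.
  by rewrite -!rmorphXn /= uB !rmorph0.
rewrite (@diag_elim _ B _ _ _ g%:MP) //.
- rewrite -!mpolyC1 -mpolyCB -mpolyCM mul_mpolyC mcoeffZ; congr (_ * _).
  congr (mcoeff _); rewrite /P horner_prod; apply: eq_bigr => i _.
  have lins d : (muni (lin K.+1 d)).[g%:MP * lin K (M K)] =
      lin K (fun a => d a + d K * g * M K a).
    rewrite muni_lin hornerD hornerC hornerZ hornerX mulrA -mpolyCM mul_mpolyC.
    by rewrite linD linZ.
  rewrite /block; case: (m i : nat) => [|k]; first by rewrite muni1 hornerC.
  rewrite muniM rmorphXn /= hornerM horner_exp !lins; congr (_ * _).
  by apply: eq_lin => a aK; rewrite [K == i]gtn_eqF ?ltn_ord // subr0; ring.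
- by rewrite -/L Lc exprMn uu mul0r.
- move=> k kB; rewrite hu -mul_polyC mpolyCM polyCM.
  by rewrite -/L Lc exprMn mulrAC !mulrA -exprS kB uu !mul0r.
- by rewrite -mpolyC1 -mpolyCB -mpolyCM gK.
Qed.

End BlockSum.

Lemma nilp_inv (R : comNzRingType) (u : R) B (x : R) :
  u ^+ B = 0 -> exists g, (1 - u * x) * g = 1.
Proof.
move=> uB; exists (\sum_(i < B) (u * x) ^+ i).
by rewrite -opprB mulNr -subrX1 exprMn uB mul0r sub0r opprK.
Qed.

(** * Typed alphabets *)

(* The type of a letter [a] is [a %% 3]: 0 for anti-excedances, 1 for fixed
   points, 2 for excedances. [accept lam i a] says whether the letter [a] may
   stand at a position of the [i]-th block of the sorted word; its last summand
   is the contribution of the letters already eliminated. [loop i] is the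
   coefficient of the letter [i], removed at one end position of its own block. *)
Section TypedLetters.
Variables (R : comNzRingType) (u : R) (B : nat).
Hypotheses (uB : u ^+ B = 0) (B0 : (0 < B)%N).
Variable W : nat -> R.

Definition accept (lam : R) (i a : nat) : R :=
  (a == i)%:R + ((a %% 3 == 2) && (a < i))%N%:R
  + ((a %% 3 == 0) && (i < a))%N%:R + lam * (a %% 3 == 2)%N%:R.

Definition loop (i : nat) : R := if (i %% 3 == 1)%N then 0 else W i.

Definition typed_sum K lam :=
  block_sum B K (fun i a => u * (W a * accept lam i a)) (fun i => u * loop i).

Let elim K lam g : (1 - u * (W K * accept lam K K)) * g = 1 ->
  typed_sum K.+1 lam = (1 - u * loop K) * g *
    block_sum B K (fun i a => u * (W a * accept lam i a)
      + u * (W K * accept lam i K) * g * (u * (W a * accept lam K a)))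
      (fun i => u * loop i).
Proof.
by move=> gK; apply: (block_sum_elim uB B0) gK.
Qed.

(** [K] exceeds every remaining letter, so all their blocks accept it with coefficient 1, while its
    own block accepts of them just the excedance letters, with coefficient [1 + lam]. The correction
    thus has the shape of the last summand of [accept]. *)
Lemma typed_sum_up K lam g : (K %% 3 = 0)%N -> (1 - u * W K) * g = 1 ->
  typed_sum K.+1 lam = typed_sum K (lam + u * W K * g * (1 + lam)).
Proof.
move=> K0 gK; rewrite (elim (g := g)); last first.
  by rewrite -[RHS]gK /accept eqxx ltnn K0 /= ?mulr1n ?mulr0n; ring.
rewrite /loop K0 /= gK mul1r; apply: eq_block_sum => i a iK aK.
rewrite /accept [K == i]gtn_eqF // [a == K]ltn_eqF // K0 iK aK /=.
by rewrite [(K < a)%N]ltnNge (ltnW aK) /= !andbF ?andbT ?mulr1n ?mulr0n; ring.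
Qed.

(** No other remaining block accepts a fixed-point letter, so the matrix is unchanged. *)
Lemma typed_sum_fix K lam g : (K %% 3 = 1)%N -> (1 - u * W K) * g = 1 ->
  typed_sum K.+1 lam = g * typed_sum K lam.
Proof.
move=> K0 gK; rewrite (elim (g := g)); last first.
  by rewrite -[RHS]gK /accept eqxx ltnn K0 /= ?mulr1n ?mulr0n; ring.
rewrite /loop K0 /= mulr0 subr0 mul1r; congr (_ * _).
apply: eq_block_sum => i a iK aK.
by rewrite [accept lam i K]/accept [K == i]gtn_eqF // K0 /= ?mulr1n ?mulr0n; ring.
Qed.

(** The remaining blocks accept [K] with coefficient [lam], and its own accepts the excedance
    letters with [1 + lam]; the equation for [g] condenses the updated scalar into [lam * g]. *)
Lemma typed_sum_down K lam g : (K %% 3 = 2)%N ->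
  (1 - u * W K * (1 + lam)) * g = 1 ->
  typed_sum K.+1 lam = (1 - u * W K) * g * typed_sum K (lam * g).
Proof.
move=> K0 gK; rewrite (elim (g := g)); last first.
  by rewrite -[RHS]gK /accept eqxx ltnn K0 /= ?mulr1n ?mulr0n; ring.
rewrite /loop K0 /=; congr (_ * _).
apply: eq_block_sum => i a iK aK.
rewrite /accept [K == i]gtn_eqF // [a == K]ltn_eqF // K0 iK aK /=.
rewrite [(K < a)%N]ltnNge [(K < i)%N]ltnNge (ltnW aK) (ltnW iK) /= !andbF ?andbT ?mulr1n ?mulr0n.
have -> : lam * g = lam + lam * (u * W K * (1 + lam)) * g.
  transitivity (lam * ((1 - u * W K * (1 + lam)) * g)
    + lam * (u * W K * (1 + lam)) * g); first by ring.
  by rewrite gK mulr1.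
ring.
Qed.

End TypedLetters.

Lemma qpochS (R : pzRingType) (a q : R) n :
  qpoch a q n.+1 = qpoch a q n * (1 - a * q ^+ n).
Proof. by rewrite /qpoch big_ord_recr. Qed.

(** * Solving the recursion for coloured letters *)

Section ColouredLetters.
Variables (R : comNzRingType) (u s q Y : R) (B r : nat).
Hypotheses (uB : u ^+ B = 0) (B0 : (0 < B)%N).

(* Letters are listed by decreasing colour [r - a %/ 3]. *)
Definition letter_weight (a : nat) : R :=
  q ^+ (r - a %/ 3) * [:: 1; Y; s]`_(a %% 3).

Local Notation tsum := (typed_sum u B letter_weight).
Local Notation P := (qpoch u q).
Local Notation Q := (qpoch (u * s * q) q).

Let weightE k t : (k <= r)%N -> (t < 3)%N ->
  letter_weight (3 * (r - k) + t) = q ^+ k * [:: 1; Y; s]`_t.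
Proof.
move=> kr t3; rewrite /letter_weight mulnC divnMDl // divn_small // addn0 subKn //.
by rewrite modnMDl modn_small.
Qed.

(* [rho = 1 / (1 + lam)] is the continuant of the letters already eliminated. *)
Let tsum_chain k lam rho : (k <= r)%N ->
  rho * (1 + lam) = 1 ->
  rho * (1 - q * s) * Q (r - k)%N = P (r - k)%N - s * q * Q (r - k)%N ->
  tsum (3 * k + 2) lam * (P r - s * q * Q r) *
    \prod_(r - k <= c < r.+1) (1 - u * Y * q ^+ c) =
  rho * (1 - q * s) * Q r * \prod_(r - k <= c < r) (1 - u * q ^+ c).
Proof.
elim: k lam rho => [|k IH] lam rho kr rhol rhoE.
  rewrite subn0 in rhoE; rewrite subn0 big_nat1 big_geq // mulr1 muln0 add0n.
  have W1 : letter_weight 1 = q ^+ r * Y.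
    by rewrite (_ : 1 = 3 * (r - r) + 1)%N ?weightE // subnn.
  have [g0 g0E] := nilp_inv (letter_weight 0) uB.
  have [g1 g1E] := nilp_inv (letter_weight 1) uB.
  rewrite (typed_sum_fix uB B0 _ (g := g1)) // (typed_sum_up uB B0 _ (g := g0)) //.
  rewrite /typed_sum block_sum0 mulr1 rhoE.
  rewrite -[RHS]mul1r -[X in _ = X * _]g1E W1; ring.
set j := (r - k.+1)%N in rhoE *.
have rkj : (r - k)%N = j.+1 by rewrite /j; lia.
have jr : (j < r)%N by rewrite /j; lia.
have kj : (k.+1 = r - j)%N by rewrite /j; lia.
have kj1 : (k = r - j.+1)%N by lia.
(* The three top letters go: the fixed-point and anti-excedance letters of colour [j], then the
   excedance letter of colour [j.+1]. *)
have -> : (3 * k.+1 + 2 = (3 * k + 2).+3)%N by lia.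
have W4 : letter_weight (3 * k + 2).+2 = q ^+ j * Y.
  by rewrite (_ : _.+2 = 3 * (r - j) + 1)%N ?weightE //; lia.
have W3 : letter_weight (3 * k + 2).+1 = q ^+ j.
  by rewrite (_ : _.+1 = 3 * (r - j) + 0)%N ?weightE ?mulr1 //; lia.
have W2 : letter_weight (3 * k + 2) = q ^+ j.+1 * s.
  by rewrite {1}kj1 weightE.
have [g4 g4E] := nilp_inv (letter_weight (3 * k + 2).+2) uB.
have [g3 g3E] := nilp_inv (letter_weight (3 * k + 2).+1) uB.
rewrite (typed_sum_fix uB B0 _ (g := g4)) //; last by lia.
rewrite (typed_sum_up uB B0 _ (g := g3)) //; last by lia.
set lam1 := (X in tsum _ X).
have lam1E : 1 + lam1 = (1 + lam) * g3.
  rewrite /lam1; have -> : 1 + (lam + u * letter_weight (3 * k + 2).+1 * g3 * (1 + lam))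
    = (1 + lam) * (1 + u * letter_weight (3 * k + 2).+1 * g3) by ring.
  congr (_ * _); rewrite -[X in X + _]g3E; ring.
rewrite W3 in g3E; rewrite W4 in g4E.
have rho1 : rho * (1 - u * q ^+ j) * (1 + lam1) = 1.
  by rewrite lam1E mulrACA rhol g3E mulr1.
move: lam1 lam1E rho1 => lam1 lam1E rho1.
pose w := u * (q ^+ j.+1 * s).
have [g2 g2E] := nilp_inv (q ^+ j.+1 * s * (1 + lam1)) uB.
have [gw gwE] := nilp_inv (q ^+ j.+1 * s) uB.
rewrite mulrA -/w in g2E; rewrite -/w in gwE.
rewrite (typed_sum_down uB B0 _ (g := g2)) //; last 2 first.
  by lia.
  by rewrite W2.
rewrite W2 -/w.
set rho' := rho * (1 - u * q ^+ j) in rho1.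
(* The inverse of [1 + lam1 * g2], that is, [rho] after the excedance letter; [gw] inverts
   [1 - w]. *)
pose rho2 := (rho' - w) * gw.
have e2 : rho2 * (1 - w) = rho' - w by rewrite /rho2 -mulrA [gw * _]mulrC gwE mulr1.
have e3 : (rho' - w) * g2 = rho'.
  have -> : rho' - w = rho' * (1 - w * (1 + lam1)) + w * (rho' * (1 + lam1) - 1).
    by ring.
  by rewrite rho1 subrr mulr0 addr0 -mulrA g2E mulr1.
have rhol2 : rho2 * (1 + lam1 * g2) = 1.
  have -> : 1 + lam1 * g2 = g2 * (1 + lam1) * (1 - w).
    by rewrite -[X in X + _]g2E; ring.
  have -> : rho2 * (g2 * (1 + lam1) * (1 - w)) =
     rho2 * (1 - w) * g2 * (1 + lam1) by ring.
  by rewrite e2 e3 rho1.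
have Qj : Q j.+1 = Q j * (1 - w).
  by rewrite qpochS /w; congr (_ * (1 - _)); rewrite exprS; ring.
have rhoE2 : rho2 * (1 - q * s) * Q j.+1 = P j.+1 - s * q * Q j.+1.
  rewrite Qj.
  have -> : rho2 * (1 - q * s) * (Q j * (1 - w)) =
    rho2 * (1 - w) * (1 - q * s) * Q j by ring.
  rewrite e2 /rho' qpochS.
  have -> : (rho * (1 - u * q ^+ j) - w) * (1 - q * s) * Q j =
    rho * (1 - q * s) * Q j * (1 - u * q ^+ j) - w * (1 - q * s) * Q j by ring.
  rewrite rhoE /w exprS; ring.
have {}IH := IH _ _ (ltnW kr) rhol2; rewrite rkj in IH; have {}IH := IH rhoE2.
rewrite big_ltn; last by lia.
rewrite [in RHS]big_ltn //.
move: IH; set T := tsum _ _; set PY := \prod_(_ <= c < r.+1) _.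
set PX := \prod_(_ <= c < r) _ => IH.
(* [g4] cancels the new factor in [Y], and [(1 - w) * g2 * rho2 = rho'] supplies the new factor
   [1 - u * q ^+ j]. *)
have -> : g4 * ((1 - w) * g2 * T) * (P r - s * q * Q r) *
    ((1 - u * Y * q ^+ j) * PY) =
    (1 - u * (q ^+ j * Y)) * g4 * ((1 - w) * g2 * (T * (P r - s * q * Q r) * PY)).
  by ring.
rewrite g4E IH.
have -> : 1 * ((1 - w) * g2 * (rho2 * (1 - q * s) * Q r * PX)) =
  (rho2 * (1 - w)) * g2 * (1 - q * s) * Q r * PX by ring.
rewrite e2 e3 /rho'; ring.
Qed.

(** The top letter, the excedance letter of colour 0, keeps [lam = 0] and its two factors cancel;
    [tsum_chain] then starts from [rho = 1], where [P 0] and [Q 0] are empty products. *)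
Lemma coloured_sum :
  tsum (3 * r.+1) 0 * ((P r - s * q * Q r) * qpoch (u * Y) q r.+1) =
  (1 - q * s) * P r * Q r.
Proof.
have -> : (3 * r.+1 = (3 * r + 2).+1)%N by lia.
have [g gE] := nilp_inv s uB.
have W2 : letter_weight (3 * r + 2) = s.
  by rewrite (_ : (3 * r + 2 = 3 * (r - 0) + 2)%N) ?weightE ?expr0 ?mul1r // subn0.
rewrite (typed_sum_down uB B0 _ (g := g)); last 2 first.
- by lia.
- by rewrite W2 addr0 mulr1.
rewrite W2 gE mul1r mul0r mulrA.
have := @tsum_chain r 0 1 (leqnn r); rewrite subnn !big_mkord => -> //.
- by rewrite -/(qpoch u q r); ring.
- by rewrite addr0 mulr1.
- by rewrite /qpoch !big_ord0; ring.
Qed.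

End ColouredLetters.

(* With [M a] the number of letters smaller than [a], positions [M a <= j < M a.+1]
   form the block of [a] in the sorted word. An anti-excedance letter must stand
   strictly before the last position of its block, an excedance letter strictly
   after the first one. *)
Definition place (M : nat -> nat) (j a : nat) : bool :=
  if (a %% 3 == 0)%N then (j < M a)%N || (j.+1 < M a.+1)%N
  else if (a %% 3 == 1)%N then (M a <= j < M a.+1)%N
  else (M a.+1 <= j)%N || (M a < j)%N.

Definition count_below n K (v : {ffun 'I_n -> 'I_K}) (a : nat) : nat :=
  (\sum_(j < n) (v j < a))%N.

Definition placed n K (v : {ffun 'I_n -> 'I_K}) : bool :=
  [forall j : 'I_n, place (count_below v) j (v j)].

(** * Placed words as terms of products of linear forms *)

Section WordSum.
Variables (R : comNzRingType) (u : R) (B : nat).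
Hypotheses (uB : u ^+ B = 0) (B0 : (0 < B)%N).
Variables (W : nat -> R) (K : nat).

Let psum (m : nat -> nat) k := (\sum_(i < k) m i)%N.

Let psum_mono m i k : (i <= k)%N -> (psum m i <= psum m k)%N.
Proof.
move=> ik; rewrite -(subnKC ik); elim: (k - i)%N => [|d IH]; first by rewrite addn0.
by rewrite addnS {2}/psum big_ord_recr /= -/(psum m _); lia.
Qed.

Let L i := lin K (fun a => u * (W a * accept 0 i a)).
Let L' i := lin K (fun a => u * (W a * accept 0 i a)
                           - (if a == i then u * loop W i else 0)).
Let Lp m j := lin K (fun a => u * W a * (place (psum m) j a)%:R).

(** Within block [i] the admissible letters change only at one end: the last position for type 0,
    the first for type 2. For type 1 [loop] vanishes and both forms agree. *)
Let LpE (m : nat -> nat) i e : (i < K)%N -> (e < m i)%N ->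
  Lp m (psum m i + e) =
  if [|| (i %% 3 == 0) && (e.+1 == m i), i %% 3 == 1 | (i %% 3 == 2) && (e == 0)]%N
  then L' i else L i.
Proof.
move=> iK ei; have psS : psum m i.+1 = (psum m i + m i)%N by rewrite /psum big_ord_recr.
set ex := [|| _, _ | _].
suff cE a : u * W a * (place (psum m) (psum m i + e) a)%:R =
    u * (W a * accept 0 i a) - (if ex && (a == i) then u * loop W i else 0).
  rewrite /Lp /L /L'; case: (ex) cE => /= cE; apply: eq_lin => a _; first exact: cE.
  by rewrite cE subr0.
have lt3 := ltn_pmod _ (isT : (0 < 3)%N).
rewrite /accept /place /loop mul0r addr0; have [ai|ai|->] := ltngtP a i.
- have h1 := psum_mono m ai; have h2 := psum_mono m (leqnSn a).
  have -> : (psum m i + e < psum m a)%N = false by lia.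
  have -> : ((psum m i + e).+1 < psum m a.+1)%N = false by lia.
  have -> : (psum m i + e < psum m a.+1)%N = false by lia.
  have -> : (psum m a.+1 <= psum m i + e)%N by lia.
  rewrite !andbF andbT /= subr0; case: (a %% 3)%N (lt3 a) => [|[|[|]]] //= _;
  by rewrite ?andbF ?mulr1n ?mulr0n; ring.
- have h1 := psum_mono m ai; have h2 := psum_mono m (leqnSn a).
  have -> : (psum m i + e < psum m a)%N by lia.
  have -> : (psum m a <= psum m i + e)%N = false by lia.
  have -> : (psum m a.+1 <= psum m i + e)%N = false by lia.
  have -> : (psum m a < psum m i + e)%N = false by lia.
  rewrite !andbF andbT /= subr0; case: (a %% 3)%N (lt3 a) => [|[|[|]]] //= _;
  by rewrite ?mulr1n ?mulr0n; ring.
- rewrite psS /ex.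
  have -> : (psum m i + e < psum m i)%N = false by lia.
  have -> : ((psum m i + e).+1 < psum m i + m i)%N = (e.+1 != m i) by lia.
  have -> : (psum m i + m i <= psum m i + e)%N = false by lia.
  have -> : (psum m i < psum m i + e)%N = (e != 0)%N by lia.
  have -> : (psum m i <= psum m i + e < psum m i + m i)%N by lia.
  rewrite !andbF andbT; case: (i %% 3)%N (lt3 i) => [|[|[|]]] //= _;
  rewrite ?orbF ?mulr1n ?mulr0n; try case: eqP => _ /=;
  by rewrite ?mulr1n ?mulr0n; ring.
Qed.

Let blockE (m : nat -> nat) i : (i < K)%N ->
  block K (fun i a => u * (W a * accept 0 i a)) (fun i => u * loop W i) i (m i) =
  \prod_(psum m i <= j < psum m i.+1) Lp m j.
Proof.
move=> iK; have -> : psum m i.+1 = (m i + psum m i)%N.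
  by rewrite /psum big_ord_recr addnC.
rewrite -[X in index_iota X _]add0n big_addn addnK.
rewrite (eq_big_nat _ _ (F2 := fun e => if [|| (i %% 3 == 0) && (e.+1 == m i),
   i %% 3 == 1 | (i %% 3 == 2) && (e == 0)]%N then L' i else L i)); last first.
  by move=> e /andP[_ em]; rewrite addnC LpE.
rewrite /block; case mi: (m i) => [|k]; first by rewrite big_geq.
rewrite -/(L i) -/(L' i).
have Lk n : \prod_(0 <= j < n) L i = L i ^+ n by rewrite prodr_const_nat subn0.
case i3: (i %% 3)%N (ltn_pmod i (isT : (0 < 3)%N)) => [|[|[|]]] //= _.
- rewrite big_nat_recr //= eqxx -Lk; congr (_ * _).
  by apply: eq_big_nat => e ek; rewrite orbF ltn_eqF.
- have -> : L' i = L i.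
    by apply: eq_lin => a _; rewrite /loop i3 /= mulr0 if_same subr0.
  by rewrite Lk exprSr.
- rewrite big_ltn //= mulrC -Lk; congr (_ * _).
  by rewrite big_add1 /=.
Qed.

Let block_prod (m : nat -> nat) k : (k <= K)%N ->
  \prod_(i < k) block K (fun i a => u * (W a * accept 0 i a))
     (fun i => u * loop W i) i (m i) = \prod_(0 <= j < psum m k) Lp m j.
Proof.
elim: k => [|k IH] kK; first by rewrite big_ord0 /psum big_ord0 big_geq.
rewrite big_ord_recr /= IH ?(ltnW kK) // blockE //.
by rewrite -big_cat_nat //= psum_mono.
Qed.

Definition content n (v : {ffun 'I_n -> 'I_K}) : 'X_{1..K} :=
  (\sum_(j < n) U_(v j))%MM.

Lemma contentE n (v : {ffun 'I_n -> 'I_K}) a : content v a = (\sum_(j < n) (v j == a))%N.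
Proof. by rewrite mnm_sumE; apply: eq_bigr => j _; rewrite mnm1E. Qed.

Let mcoeff_prod_lin n (c : nat -> nat -> R) (m : 'X_{1..K}) :
  (\prod_(0 <= j < n) lin K (c j))@_m =
  \sum_(v : {ffun 'I_n -> 'I_K} | content v == m) \prod_(j < n) c j (v j).
Proof.
rewrite big_mkord /lin bigA_distr_bigA raddf_sum [RHS]big_mkcond /=.
apply: eq_bigr => v _.
rewrite (_ : \prod_(j < n) _ = (\prod_(j < n) c j (v j)) *: 'X_[content v]).
  by rewrite mcoeffZ mcoeffX; case: eqP; rewrite ?mulr1 ?mulr0.
by rewrite scaler_prod mprodXE.
Qed.

(** The sorted word, hence the form at each position, depends on the content alone, so the
    coefficient at a content collects the placed words with that content. *)
Lemma word_sum : typed_sum u B W K 0 =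
  \sum_(n < B) \sum_(v : {ffun 'I_n -> 'I_K} | placed v)
     \prod_(j < n) (u * W (v j)).
Proof.
pose mm (m : {ffun 'I_K -> 'I_B}) := [multinom (m i : nat) | i < K].
pose nm (m : {ffun 'I_K -> 'I_B}) (i : nat) :=
  oapp (fun i : 'I_K => (m i : nat)) 0%N (insub i).
have nmE m (i : 'I_K) : nm m i = m i by rewrite /nm valK.
pose F n (v : {ffun 'I_n -> 'I_K}) :=
  if placed v then \prod_(j < n) (u * W (v j)) else 0.
have content_deg n (v : {ffun 'I_n -> 'I_K}) m :
    content v = mm m -> n = psum (nm m) K.
  move=> /(congr1 (@mdeg K)); rewrite mdeg_sum (eq_bigr (fun=> 1%N)) => [|j _].
    rewrite sum1_card card_ord mdegE => ->.
    by apply: eq_bigr => i _; rewrite mnmE nmE.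
  by rewrite mdeg1.
have content_count n (v : {ffun 'I_n -> 'I_K}) m a : (a <= K)%N ->
    content v = mm m -> psum (nm m) a = count_below v a.
  move=> aK vm; rewrite /psum /count_below.
  rewrite (big_ord_widen_cond K (fun=> true) (nm m)) //.
  rewrite (eq_bigr (fun i : 'I_K => content v i)) => [|i _]; last first.
    by rewrite vm mnmE nmE.
  rewrite (eq_bigr (fun i : 'I_K => (\sum_(j < n) (v j == i))%N)) => [|i _]; last first.
    by rewrite contentE.
  rewrite exchange_big /=; apply: eq_bigr => j _.
  rewrite big_mkcond (bigD1 (v j)) //= eqxx big1 ?addn0; first by case: ltnP.
  by move=> i /negbTE; rewrite eq_sym => ->; rewrite if_same.
transitivity (\sum_(m : {ffun 'I_K -> 'I_B}) \sum_(n < B)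
    \sum_(v : {ffun 'I_n -> 'I_K} | content v == mm m) F n v).
  apply: eq_bigr => m _; rewrite -/(mm m).
  rewrite (eq_bigr (fun i : 'I_K => block K (fun i a => u * (W a * accept 0 i a))
     (fun i => u * loop W i) i (nm m i))) => [|i _]; last by rewrite nmE.
  rewrite block_prod // mcoeff_prod_lin; set N := psum _ _.
  (* Contents of degree [B] or more vanish, as every letter brings a factor [u]. *)
  have [NB|BN] := ltnP N B; last first.
    have uN : u ^+ N = 0 by rewrite -(subnKC BN) exprD uB mul0r.
    rewrite big1 => [|v _]; last first.
      under eq_bigr do rewrite -mulrA.
      by rewrite big_split /= prodr_const card_ord uN mul0r.
    rewrite big1 // => n _; rewrite big1 // => v /eqP /content_deg.
    by have := ltn_ord n; rewrite -/N => nB nN; move: nB; rewrite {1}nN; lia.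
  rewrite [RHS](bigD1 (Ordinal NB)) //= [X in _ = _ + X]big1 ?addr0; last first.
    move=> n /eqP nN; rewrite big1 // => v /eqP /content_deg e.
    by case: nN; apply: val_inj.
  apply: eq_bigr => v /eqP vm; rewrite /F.
  have plE (j : 'I_N) : place (psum (nm m)) j (v j) = place (count_below v) j (v j).
    by rewrite /place !(content_count _ _ _ _ _ vm) ?(ltnW (ltn_ord _)).
  have [/forallP pl|] := boolP (placed v).
    by apply: eq_bigr => j _; rewrite plE pl mulr1.
  rewrite negb_forall => /existsP [j /negbTE nj].
  by rewrite (bigD1 j) //= plE nj mulr0 mul0r.
rewrite exchange_big /=; apply: eq_bigr => n _.
rewrite [RHS]big_mkcond /=.
(* Words shorter than [B] have multiplicities below [B], so no content is lost. *)
have bnd (v : {ffun 'I_n -> 'I_K}) a : (content v a < B)%N.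
  apply: leq_ltn_trans (ltn_ord n); rewrite contentE.
  apply: leq_trans (_ : \sum_(j < n) 1 <= _)%N; last by rewrite sum1_card card_ord.
  by apply: leq_sum => j _; apply: leq_b1.
rewrite [RHS](partition_big (fun v => [ffun a => Ordinal (bnd v a)]) predT) //=.
apply: eq_bigr => m _; apply: eq_bigl => v.
apply/eqP/eqP => [vm|<-]; last by apply/mnmP => a; rewrite mnmE ffunE.
by apply/ffunP => a; apply: val_inj; rewrite ffunE /= vm mnmE.
Qed.

End WordSum.

(** * Standardization *)

Section Standardization.
Local Open Scope nat_scope.
Variables (n K : nat) (v : {ffun 'I_n -> 'I_K}).

(** The order of the stable sort. *)
Definition wlt (i j : 'I_n) : bool := (v i < v j) || ((v i == v j) && (i < j)).

Definition wrank (j : 'I_n) : nat := \sum_(i < n) wlt i j.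

Lemma wlt_trans : transitive wlt.
Proof. by move=> j i k; rewrite /wlt -!val_eqE /=; lia. Qed.

Lemma wlt_irr : irreflexive wlt.
Proof. by move=> j; rewrite /wlt !ltnn andbF. Qed.

Lemma wlt_total i j : i != j -> wlt i j || wlt j i.
Proof. by rewrite /wlt -!val_eqE /=; lia. Qed.

Lemma wlt_rank i j : wlt i j -> wrank i < wrank j.
Proof.
move=> ij; rewrite /wrank (bigD1 i) //= [X in _ < X](bigD1 i) //= ij wlt_irr.
rewrite add0n add1n ltnS; apply: leq_sum => k _.
by case ki: (wlt k i); rewrite // (wlt_trans ki ij).
Qed.

Lemma wrank_lt j : wrank j < n.
Proof.
rewrite -[X in _ < X]card_ord -sum1_card /wrank (bigD1 j) //= wlt_irr add0n.
rewrite [X in _ < X](bigD1 j) //= add1n ltnS.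
by apply: leq_sum => i _; apply: leq_b1.
Qed.

Definition rank_ord (j : 'I_n) : 'I_n := Ordinal (wrank_lt j).

Lemma rank_ord_inj : injective rank_ord.
Proof.
move=> i j /(congr1 val) /= ij; apply/eqP; apply: contraT => /wlt_total.
by case/orP => /wlt_rank; rewrite ij ltnn.
Qed.

Definition rank_perm : 'S_n := perm rank_ord_inj.

Lemma rank_permE j : rank_perm j = wrank j :> nat.
Proof. by rewrite permE. Qed.

Lemma sum_interval (x y : nat) : \sum_(i < n) (x <= i < y) <= y - x.
Proof.
rewrite -(big_mkord predT (fun i => (x <= i < y) : nat)).
elim: n => [|m IH]; first by rewrite big_geq.
rewrite big_nat_recr //=.
have : \sum_(0 <= i < m) (x <= i < y) <= minn m y - x.
  elim: m {IH} => [|m IH]; first by rewrite big_geq.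
  by rewrite big_nat_recr //=; lia.
lia.
Qed.

Lemma wrank_count j :
  wrank j = count_below v (v j) + \sum_(i < n) ((v i == v j) && (i < j)).
Proof.
rewrite /wrank /count_below -big_split /=; apply: eq_bigr => i _.
by rewrite /wlt -val_eqE /=; lia.
Qed.

Lemma wrank_countr j :
  count_below v (v j).+1 =
  (wrank j + \sum_(i < n) ((v i == v j) && (j < i))).+1.
Proof.
rewrite wrank_count /count_below -!big_split /= (bigD1 j) //=.
rewrite [in RHS](bigD1 j) //= !ltnn ltnSn !andbF !addn0 add0n add1n; congr _.+1.
by apply: eq_bigr => i; rewrite -!val_eqE /=; lia.
Qed.

(** For [x = sigma i] and [y = i] this is the letter type of an anti-excedance, fixed point or
    excedance. *)
Definition cmp_code (x y : nat) : nat := if x < y then 0 else if x == y then 1 else 2.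

(* If all occurrences of the letter of [j] lie in [[lo, hi[], at most [j - lo] of
   them precede [j] and at most [hi - j.+1] follow it. *)
Lemma placedP :
  reflect (forall j : 'I_n, v j %% 3 = cmp_code j (wrank j)) (placed v).
Proof.
apply: (iffP forallP) => H j; last first.
  have := H j; rewrite /place => ->; rewrite /cmp_code.
  have := wrank_count j; have := wrank_countr j.
  by case: ltngtP => /=; lia.
have bounds lo hi : (forall i : 'I_n, v i = v j -> lo <= i < hi) ->
    wrank j <= count_below v (v j) + (j - lo) /\
    count_below v (v j).+1 <= (wrank j + (hi - j.+1)).+1.
  move=> bd; rewrite wrank_countr ltnS leq_add2l {1}wrank_count leq_add2l; split.
    apply: leq_trans (sum_interval lo j); apply: leq_sum => i _.
    by case: eqP => //= /bd /andP[-> _].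
  apply: leq_trans (sum_interval j.+1 hi); apply: leq_sum => i _.
  by case: eqP => //= /bd /andP[_ ->]; rewrite andbT.
have lt3 := ltn_pmod (v j) (isT : 0 < 3).
have pl (i : 'I_n) : v i = v j -> place (count_below v) i (v j) by move=> <-.
have mono i : v i = v j -> count_below v (v j) < count_below v (v j).+1.
  by move=> _; rewrite wrank_countr wrank_count; lia.
have plj := pl j erefl; have mj := mono j erefl.
case v3: (v j %% 3) lt3 => [|[|[|]]] // _; rewrite /place v3 /= in pl plj.
(* The last position of the block is closed to its own anti-excedance letter, so counting the copies
   after [j] gives [j < wrank j]. For an excedance letter the copies before [j] are counted. *)
- have /bounds : forall i : 'I_n, v i = v j -> 0 <= i < (count_below v (v j).+1).-1.
    by move=> i /pl; lia.
  by rewrite /cmp_code; case: ltnP => //; lia.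
- have /bounds : forall i : 'I_n, v i = v j ->
    count_below v (v j) <= i < count_below v (v j).+1 by move=> i /pl.
  by rewrite /cmp_code; case: ltngtP => //; lia.
- have /bounds : forall i : 'I_n, v i = v j -> (count_below v (v j)).+1 <= i < n.
    by move=> i /pl; have := ltn_ord i; lia.
  by rewrite /cmp_code; case: ltngtP => //; have := ltn_ord j; lia.
Qed.

End Standardization.

(** * Compatible pairs and placed words *)

Definition compatible n r (sigma : 'S_n) (b : {ffun 'I_n -> 'I_r.+1}) : bool :=
  [forall i : 'I_n, forall j : 'I_n,
     (j == i.+1 :> nat) ==> (b j + (sigma j < sigma i) <= b i)%N].

Section PermutationsAsWords.
Variables n r : nat.
Implicit Types (sigma : 'S_n) (b : {ffun 'I_n -> 'I_r.+1}).
Implicit Types (v : {ffun 'I_n -> 'I_(3 * r.+1)}).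

Lemma label_proof sigma b (i : 'I_n) :
  (3 * (r - b i) + cmp_code (sigma i) i < 3 * r.+1)%N.
Proof. by rewrite /cmp_code; have := ltn_ord (b i); case: ifP => _; try case: ifP => _; lia. Qed.

Definition label sigma b i : 'I_(3 * r.+1) := Ordinal (label_proof sigma b i).

Definition word_of sigma b : {ffun 'I_n -> 'I_(3 * r.+1)} :=
  [ffun j => label sigma b ((sigma^-1)%g j)].

Definition perm_of v : 'S_n := ((rank_perm v)^-1)%g.

Definition colour_of v : {ffun 'I_n -> 'I_r.+1} :=
  [ffun i => inord (r - v (perm_of v i) %/ 3)].

Lemma word_ofE sigma b i : word_of sigma b (sigma i) = label sigma b i.
Proof. by rewrite ffunE permK. Qed.

(** By transitivity consecutive positions suffice. If the colour drops, the letter grows. If it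
    stays, [sigma] increases, so the type does not decrease, and equal letters are ordered by
    position. *)
Lemma wlt_word_of sigma b : compatible sigma b ->
  forall i j : 'I_n, wlt (word_of sigma b) (sigma i) (sigma j) = (i < j)%N.
Proof.
move=> cb; set w := word_of _ _.
have step (i j : 'I_n) : (j = i.+1 :> nat) -> wlt w (sigma i) (sigma j).
  move=> ji; have /forallP/(_ i)/forallP/(_ j) := cb; rewrite ji eqxx /=.
  have : sigma i != sigma j.
    by apply/eqP => /perm_inj ij; rewrite ij in ji; lia.
  rewrite /wlt !word_ofE -!val_eqE /= /cmp_code ji => sij.
  have := ltn_ord (b i); have := ltn_ord (b j).
  by case: (ltngtP (sigma i) (sigma j)) sij => // sij _;
     case: (ltngtP (sigma i) i) => ?; case: (ltngtP (sigma j) i.+1) => ?; lia.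
have lt d (i j : 'I_n) : (j = i + d.+1 :> nat)%N -> wlt w (sigma i) (sigma j).
  elim: d j => [|d IH] j ji; first by apply: step; lia.
  have kn : (i + d.+1 < n)%N by have := ltn_ord j; lia.
  apply: (@wlt_trans _ _ _ (sigma (Ordinal kn))); first exact: IH.
  by apply: step => /=; lia.
have lt' (i j : 'I_n) : (i < j)%N -> wlt w (sigma i) (sigma j).
  by move=> ij; apply: (lt (j - i).-1); lia.
move=> i j; case: (ltngtP i j) => [/lt' //|/lt' ji|/val_inj ->].
  by apply/negP => /(wlt_trans ji); rewrite wlt_irr.
exact: wlt_irr.
Qed.

Lemma rank_word_of sigma b : compatible sigma b ->
  rank_perm (word_of sigma b) = (sigma^-1)%g.
Proof.
move=> cb; apply/permP => j; rewrite -[j](permKV sigma) permK.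
move: ((sigma^-1)%g j) => i; apply: val_inj; rewrite /= rank_permE /wrank.
rewrite (reindex_inj (@perm_inj _ sigma)) /=.
under eq_bigr do rewrite wlt_word_of //.
suff -> m : (\sum_(k < m) (k < i) = minn m i)%N by have := ltn_ord i; lia.
by elim: m => [|m IH]; rewrite ?big_ord0 ?big_ord_recr //= ?IH; lia.
Qed.

Lemma perm_of_word sigma b : compatible sigma b ->
  perm_of (word_of sigma b) = sigma.
Proof. by move=> cb; rewrite /perm_of rank_word_of // invgK. Qed.

Lemma colour_of_word sigma b : compatible sigma b ->
  colour_of (word_of sigma b) = b.
Proof.
move=> cb; apply/ffunP => i; apply: val_inj; rewrite ffunE perm_of_word //.
rewrite word_ofE /= mulnC divnMDl // divn_small ?addn0; last first.
  by rewrite /cmp_code; case: ifP => // _; case: ifP.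
have bi : (b i <= r)%N by rewrite -ltnS.
by rewrite subKn // inordK.
Qed.

Lemma word_of_rank v j :
  word_of (perm_of v) (colour_of v) j = (3 * (v j %/ 3) + cmp_code j (wrank v j))%N :> nat.
Proof.
rewrite ffunE /= permKV -rank_permE /perm_of invgK.
have vr : (v j %/ 3 <= r)%N by have := ltn_ord (v j); lia.
by rewrite ffunE /perm_of permK inordK ?subKn ?ltnS ?leq_subr.
Qed.

(** By [word_of_rank] the round trip keeps colours and replaces each type by the comparison of
    position and rank; it fixes [v] exactly under the condition of [placedP]. *)
Lemma compatible_placed v :
  compatible (perm_of v) (colour_of v) && (word_of (perm_of v) (colour_of v) == v)
  = placed v.
Proof.
apply/andP/placedP => [[_ /eqP wv] j|H].
  by have := word_of_rank v j; rewrite wv; lia.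
split; last first.
  by apply/eqP/ffunP => j; apply: val_inj; rewrite /= word_of_rank -H; lia.
(* At consecutive ranks the colours weakly decrease; where they agree, the types or the tie rule
   force the positions to increase, so there is no descent. *)
apply/forallP => i; apply/forallP => j; apply/implyP => /eqP ji.
rewrite !ffunE.
set x := perm_of v i; set y := perm_of v j.
have xr : wrank v x = i by rewrite -rank_permE /x /perm_of permKV.
have yr : wrank v y = j by rewrite -rank_permE /y /perm_of permKV.
have xy : wlt v x y.
  have : x != y by apply/eqP => e; move: xr; rewrite e yr; lia.
  by move=> /(wlt_total v) /orP[//|/wlt_rank]; lia.
have vx : (v x %/ 3 <= r)%N by have := ltn_ord (v x); lia.
have vy : (v y %/ 3 <= r)%N by have := ltn_ord (v y); lia.
rewrite !inordK ?ltnS ?leq_subr //.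
have := H x; have := H y; rewrite xr yr ji /cmp_code; move: xy; rewrite /wlt -val_eqE /=.
by case: (ltngtP x i) => ?; case: (ltngtP y i.+1) => ?; lia.
Qed.

Section Weights.
Variables (R : comNzRingType) (s q Y : R).

Lemma letter_weight_word sigma b :
  q ^+ (\sum_i b i) * s ^+ exc sigma * Y ^+ fix_ sigma =
  \prod_(j < n) letter_weight s q Y r (word_of sigma b j).
Proof.
rewrite [RHS](reindex_inj (@perm_inj _ sigma)) /=.
rewrite expr_sum /exc /fix_ -!prodr_const.
rewrite [X in _ * X * _]big_mkcond [X in _ * X]big_mkcond -!big_split /=.
apply: eq_bigr => i _; rewrite word_ofE /letter_weight /= !inE.
have b3 : (cmp_code (sigma i) i < 3)%N by rewrite /cmp_code; case: ifP => // _; case: ifP.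
have -> : ((3 * (r - b i) + cmp_code (sigma i) i) %/ 3 = r - b i)%N by lia.
have -> : ((3 * (r - b i) + cmp_code (sigma i) i) %% 3 = cmp_code (sigma i) i)%N by lia.
have bi : (b i <= r)%N by rewrite -ltnS.
rewrite subKn // -mulrA; congr (_ * _); rewrite /cmp_code -val_eqE /=.
have := ltn_ord (sigma i).
case: (ltngtP (sigma i) i) => si sn; rewrite ?andbF ?andbT ?mulr1 ?mul1r //.
by rewrite (leq_ltn_trans si sn).
Qed.

Lemma sum_compatible :
  \sum_(sigma : 'S_n) \sum_(b : {ffun 'I_n -> 'I_r.+1} | compatible sigma b)
     q ^+ (\sum_i b i) * s ^+ exc sigma * Y ^+ fix_ sigma =
  \sum_(v : {ffun 'I_n -> 'I_(3 * r.+1)} | placed v)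
     \prod_(j < n) letter_weight s q Y r (v j).
Proof.
rewrite pair_big_dep /=.
rewrite (reindex_onto (fun v => (perm_of v, colour_of v))
                      (fun p => word_of p.1 p.2)) /=; last first.
  by case=> sigma b /= cb; rewrite perm_of_word // colour_of_word.
apply: eq_big => [v|v /andP[_ /eqP wv]]; first exact: compatible_placed.
by rewrite letter_weight_word wv.
Qed.

End Weights.
End PermutationsAsWords.

(** * The generating function of compatible pairs for a fixed colour bound *)

Definition colour_sum (R : comNzRingType) (s q Y : R) (r n : nat) : R :=
  \sum_(sigma : 'S_n) \sum_(b : {ffun 'I_n -> 'I_r.+1} | compatible sigma b)
     q ^+ (\sum_i b i) * s ^+ exc sigma * Y ^+ fix_ sigma.

Section Morphisms.
Variables (R S : comNzRingType) (f : {rmorphism R -> S}).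

Lemma rmorph_qpoch a q n : f (qpoch a q n) = qpoch (f a) (f q) n.
Proof.
rewrite /qpoch rmorph_prod; apply: eq_bigr => i _.
by rewrite rmorphB rmorph1 rmorphM rmorphXn.
Qed.

Lemma rmorph_colour_sum s q Y r n :
  f (colour_sum s q Y r n) = colour_sum (f s) (f q) (f Y) r n.
Proof.
rewrite rmorph_sum; apply: eq_bigr => sigma _; rewrite rmorph_sum.
by apply: eq_bigr => b _; rewrite !rmorphM !rmorphXn.
Qed.

End Morphisms.

Definition modeq (R : comNzRingType) (x : R) (N : nat) (a b : R) : Prop :=
  exists h, a = b + x ^+ N * h.

Section ColourSeries.
Variable R : comNzRingType.

Definition colour_num (u s q : R) r : R :=
  (1 - q * s) * qpoch u q r * qpoch (u * s * q) q r.

Definition colour_den (u s q Y : R) r : R :=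
  (qpoch u q r - s * q * qpoch (u * s * q) q r) * qpoch (u * Y) q r.+1.

Lemma colour_series_nilp (u s q Y : R) B r : u ^+ B = 0 -> (0 < B)%N ->
  (\sum_(n < B) u ^+ n * colour_sum s q Y r n) * colour_den u s q Y r =
  colour_num u s q r.
Proof.
move=> uB B0; rewrite /colour_num -(coloured_sum s q Y r uB B0); congr (_ * _).
rewrite (word_sum uB B0); apply: eq_bigr => n _.
rewrite /colour_sum sum_compatible mulr_sumr; apply: eq_bigr => v _.
by rewrite [RHS]big_split /= prodr_const card_ord.
Qed.

End ColourSeries.

(* Working modulo [u ^ B] turns [u] into a nilpotent element. *)
Lemma colour_series (R : comNzRingType) (u s q Y : R) B r : (0 < B)%N ->
  modeq u B ((\sum_(n < B) u ^+ n * colour_sum s q Y r n) * colour_den u s q Y r)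
            (colour_num u s q r).
Proof.
move=> B0; pose f : {rmorphism {poly R} -> {poly %/ ('X^B : {poly R})}} := in_qpoly ('X^B : {poly R}).
have mX : mk_monic ('X^B : {poly R}) = 'X^B by rewrite mk_monic_Xn prednK.
have fX : f 'X ^+ B = 0.
  rewrite -rmorphXn; apply: val_inj; rewrite /= mX.
  by rewrite Pdiv.RingMonic.rmodpp ?monicXn.
pose lhs (A : comNzRingType) (u s q Y : A) : A :=
  (\sum_(n < B) u ^+ n * colour_sum s q Y r n) * colour_den u s q Y r.
have lhsM (A A' : comNzRingType) (g : {rmorphism A -> A'}) u1 s1 q1 Y1 :
    g (lhs A u1 s1 q1 Y1) = lhs A' (g u1) (g s1) (g q1) (g Y1).
  rewrite /lhs /colour_den !(rmorphM, rmorphB, rmorph_qpoch) rmorph_sum.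
  by congr (_ * _); apply: eq_bigr => n _; rewrite rmorphM rmorphXn rmorph_colour_sum.
have numM (A A' : comNzRingType) (g : {rmorphism A -> A'}) u1 s1 q1 :
    g (colour_num u1 s1 q1 r) = colour_num (g u1) (g s1) (g q1) r.
  by rewrite /colour_num !(rmorphM, rmorphB, rmorph1, rmorph_qpoch).
have e : f (lhs _ 'X s%:P q%:P Y%:P - colour_num 'X s%:P q%:P r) = 0.
  rewrite rmorphB lhsM numM; apply/eqP; rewrite subr_eq0; apply/eqP.
  exact: colour_series_nilp.
have := congr1 val e; rewrite /= mX => {}e.
(* With remainder zero, the difference is a multiple of ['X^B]; evaluation at [u] carries this to
   [R]. *)
have := Pdiv.RingMonic.rdivp_eq (monicXn R B)
  (lhs _ 'X s%:P q%:P Y%:P - colour_num 'X s%:P q%:P r).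
rewrite e addr0 => /(congr1 (horner_eval u)).
rewrite rmorphB lhsM numM rmorphM rmorphXn /= /horner_eval hornerX !hornerC.
set h := (_.[u]); move=> E; exists h; rewrite [_ * h]mulrC -E.
by rewrite addrC subrK.
Qed.

(** * MacMahon's Verfahren *)

Section Congruence.
Variables (R : comNzRingType) (x : R) (N : nat).

Lemma modeq_refl a : modeq x N a a.
Proof. by exists 0; rewrite mulr0 addr0. Qed.

Lemma modeqMl c a b : modeq x N a b -> modeq x N (c * a) (c * b).
Proof. by move=> [h ->]; exists (c * h); rewrite mulrDr mulrCA. Qed.

End Congruence.

Section Chains.
Variable R : comNzRingType.
Implicit Types (d : seq nat) (t q : R).

Fixpoint chain_sum q d (r : nat) : R :=
  if d is x :: d' then
    \sum_(b < r.+1) if (x <= b)%N then q ^+ b * chain_sum q d' (b - x) else 0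
  else 1.

Fixpoint chain d (b : nat -> nat) (r : nat) : bool :=
  if d is x :: d' then
    [&& b 0 <= r, x <= b 0 & chain d' (fun i => b i.+1) (b 0 - x)]%N
  else true.

Lemma chainP d b r : b (size d) = 0%N ->
  reflect ((0 < size d -> b 0 <= r)%N /\
           (forall i, i < size d -> b i.+1 + nth 0 d i <= b i)%N) (chain d b r).
Proof.
elim: d b r => [|x d IH] b r bd; first by left.
apply: (iffP and3P) => [[b0 xb /(IH (fun i => b i.+1) _ bd) [b1 bS]]|[b0 bS]].
  split=> // -[_|i] /=; last exact: bS.
  by move: bd b1 => /=; case: (size d) => [->|k] //; lia.
split; [exact: b0|by have := bS 0%N isT; rewrite /=; lia|].
apply/(IH (fun i => b i.+1)) => //; split => [_|i id].
  by have := bS 0%N isT; rewrite /=; lia.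
exact: (bS i.+1).
Qed.

(** Padding by 0 makes the last inequality of a chain, which has no successor, an instance of the
    general one. *)
Definition extend n M (f : {ffun 'I_n -> 'I_M}) (i : nat) : nat :=
  oapp (fun j : 'I_n => f j : nat) 0%N (insub i).

Lemma ext_ord n M (f : {ffun 'I_n -> 'I_M}) (i : 'I_n) : extend f i = f i.
Proof. by rewrite /extend valK. Qed.

Lemma ext_out n M (f : {ffun 'I_n -> 'I_M}) i : (n <= i)%N -> extend f i = 0%N.
Proof. by move=> ni; rewrite /extend insubF // ltnNge ni. Qed.

(** The codomain bound [M] is kept apart from [r], which shrinks along the induction. *)
Lemma sum_chain q d n M r : size d = n -> (r <= M)%N ->
  \sum_(f : {ffun 'I_n -> 'I_M.+1} | chain d (extend f) r) q ^+ (\sum_i f i)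
  = chain_sum q d r.
Proof.
move=> <-; elim: d r => [|x d IH] r rM.
  rewrite (eq_bigr (fun=> 1)) => [|f _]; last by rewrite big_ord0 expr0.
  by rewrite sumr_const card_ffun !card_ord expn0.
rewrite big_mkcond big_ffcons /=.
rewrite (big_ord_widen_cond M.+1 predT (fun b => if (x <= b)%N then q ^+ b * chain_sum q d (b - x) else 0)) ?ltnS //.
rewrite [RHS]big_mkcond; apply: eq_bigr => b _ /=.
have ext0 f : extend (@ffcons _ (size d) b f) 0 = b.
  by rewrite -[0%N]/(nat_of_ord (@ord0 (size d))) ext_ord ffcons0.
have extS (f : {ffun 'I_(size d) -> 'I_M.+1}) i : extend (ffcons b f) i.+1 = extend f i.
  have [iltd|dlei] := ltnP i (size d); last by rewrite !ext_out.
  rewrite -[i]/(nat_of_ord (Ordinal iltd)) ext_ord.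
  rewrite -(ffconsS b f (Ordinal iltd)).
  exact: (ext_ord (ffcons b f) (lift ord0 (Ordinal iltd))).
have chE (f : {ffun 'I_(size d) -> 'I_M.+1}) (k : nat) :
    chain d (fun i => extend (ffcons b f) i.+1) k = chain d (extend f) k.
  suff ch (b1 b2 : nat -> nat) : b1 =1 b2 -> chain d b1 k = chain d b2 k.
    by apply: ch => i; rewrite extS.
  elim: d k b1 b2 {IH ext0 extS f} => //= y d IHd k b1 b2 b12.
  by rewrite !b12 (IHd _ _ (fun i => b2 i.+1)).
rewrite ltnS; case: leqP => br /=; last first.
  by rewrite big1 // => f _; rewrite ext0 leqNgt br.
case: leqP => xb /=; last first.
  by rewrite big1 // => f _; rewrite ext0 (leqNgt x) xb andbF.
rewrite -(IH (b - x)%N); last by have := ltn_ord b; lia.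
rewrite mulr_sumr [RHS]big_mkcond; apply: eq_bigr => f _.
rewrite ext0 br xb chE /=; case: ifP => // _.
rewrite -exprD big_ord_recl ffcons0; congr (_ ^+ (_ + _)).
by apply: eq_bigr => i _; rewrite ffconsS.
Qed.

(** Splitting off the first term of the chain gives the factor [1 - T], and the shift by [x]
    replaces [T] by [T * q]; hence the induction is over all multiples [T] of [t]. *)
Lemma chain_series q d t N (T : R) : (exists c, T = t * c) ->
  modeq t N ((\sum_(r < N) T ^+ r * chain_sum q d r) * qpoch T q (size d).+1)
    (\prod_(i < size d) (T * q ^+ i.+1) ^+ nth 0%N d i).
Proof.
elim: d T => [|x d IH] T [c Tc].
  exists (- c ^+ N); rewrite big_ord0 /qpoch big_ord1 expr0 mulr1.
  under eq_bigr do rewrite mulr1.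
  by rewrite mulrN -exprMn -Tc mulrC -[LHS]opprK -mulNr opprB -subrX1 opprB.
have TN (k : nat) : (N <= k)%N -> T ^+ k = t ^+ N * (c ^+ N * T ^+ (k - N)).
  by move=> Nk; rewrite mulrA -exprMn -Tc -exprD subnKC.
have qS : qpoch T q (size d).+2 = (1 - T) * qpoch (T * q) q (size d).+1.
  rewrite /qpoch big_ord_recl expr0 mulr1; congr (_ * _).
  by apply: eq_bigr => i _; rewrite /= /bump add1n exprS mulrA.
pose term (r : nat) := if (x <= r)%N then q ^+ r * chain_sum q d (r - x) else 0.
(* Summation by parts: consecutive chain sums differ by [term]. *)
have telescope M : (\sum_(r < M) T ^+ r * chain_sum q (x :: d) r) * (1 - T) =
    \sum_(r < M) T ^+ r * term r - T ^+ M * (\sum_(r < M) term r).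
  elim: M => [|M IHM]; first by rewrite !big_ord0 mul0r mulr0 subrr.
  rewrite !big_ord_recr /= mulrDl IHM big_ord_recr /= -/(term M) exprS.
  move: (term M) (\sum_(_ < M) _) => a e.
  move: (\sum_(_ < M) _) => f; ring.
have shift : \sum_(r < N) T ^+ r * term r =
    (T * q) ^+ x * (\sum_(r < N - x) (T * q) ^+ r * chain_sum q d r).
  have [Nx|xN] := leqP N x.
    rewrite (_ : (N - x = 0)%N) ?big_ord0 ?mulr0; last lia.
    by rewrite big1 // => i _; rewrite /term leqNgt (leq_trans (ltn_ord i)) // mulr0.
  rewrite -(big_mkord predT (fun r => T ^+ r * term r)) (big_cat_nat (n := x)) //=; last exact: ltnW.
  rewrite big_nat big1 ?add0r => [|i /andP[_ ix]]; last by rewrite /term leqNgt ix mulr0.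
  rewrite -[X in index_iota X _]add0n big_addn big_mkord mulr_sumr.
  apply: eq_bigr => i _; rewrite /term leq_addl addnK mulrA -exprMn mulrA -exprD.
  by rewrite addnC.
(* Lengthening the shifted sum from [N - x] to [N] terms adds only multiples of [T ^+ N], hence of
   [t ^+ N]. *)
have [h hE] : modeq t N (\sum_(r < N) T ^+ r * term r)
    ((T * q) ^+ x * (\sum_(r < N) (T * q) ^+ r * chain_sum q d r)).
  rewrite shift.
  exists (- (\sum_(N - x <= r < N) c ^+ N * T ^+ (x + r - N) * (q ^+ (x + r) * chain_sum q d r))).
  rewrite -[in X in _ = X + _](big_mkord predT (fun r => (T * q) ^+ r * chain_sum q d r)).
  rewrite (big_cat_nat (n := (N - x)%N)) //= ?leq_subr // mulrDr big_mkord.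
  rewrite mulrN -addrA -[LHS]addr0; congr (_ + _); apply/eqP.
  rewrite eq_sym subr_eq0; apply/eqP; rewrite !mulr_sumr.
  apply: eq_big_nat => i /andP[iN _].
  rewrite mulrA -exprD exprMn (TN (x + i)%N); last lia.
  by rewrite !mulrA.
have Tqc : exists c', T * q = t * c' by exists (c * q); rewrite Tc mulrA.
have {}IH := IH _ Tqc.
rewrite qS mulrA telescope hE big_ord_recl /= expr1.
rewrite (TN N) // subnn expr0 mulr1.
case: IH => k kE.
exists ((T * q) ^+ x * k + (h - c ^+ N * \sum_(r < N) term r) * qpoch (T * q) q (size d).+1).
rewrite (eq_bigr (fun i : 'I_(size d) => (T * q * q ^+ i.+1) ^+ nth 0%N d i)); last first.
  by move=> i _; rewrite /bump /= add1n [in LHS]exprS !mulrA.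
transitivity ((T * q) ^+ x * ((\sum_(r < N) (T * q) ^+ r * chain_sum q d r) * qpoch (T * q) q (size d).+1)
  + t ^+ N * ((h - c ^+ N * \sum_(r < N) term r) * qpoch (T * q) q (size d).+1)).
  by ring.
by rewrite kE; ring.
Qed.

End Chains.

(** Compatible colourings are the chains whose required drops [d] are the descent indicators; the
    factors [(t * q ^+ i.+1) ^+ d_i] then multiply to the monomial of [des] and [maj]. *)
Lemma macmahon (R : comNzRingType) (t q : R) n (sigma : 'S_n) N :
  modeq t N
    ((\sum_(r < N) t ^+ r *
        \sum_(b : {ffun 'I_n -> 'I_r.+1} | compatible sigma b) q ^+ (\sum_i b i))
     * qpoch t q n.+1)
    (t ^+ des sigma * q ^+ maj sigma).
Proof.
pose d := [seq ((i \in descents sigma) : nat) | i : 'I_n].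
have sd : size d = n by rewrite size_map size_enum_ord.
have dE (i : 'I_n) : nth 0%N d i = (i \in descents sigma).
  by rewrite (nth_map i) ?size_enum_ord ?ltn_ord // nth_ord_enum.
have descE (i j : 'I_n) : (j = i.+1 :> nat) ->
    (i \in descents sigma) = (sigma j < sigma i)%N.
  move=> ji; rewrite inE; apply/existsP/idP => [[k /andP[/eqP ki]]|sji].
    by rewrite (_ : k = j) //; apply: val_inj; rewrite /= ki.
  by exists j; rewrite ji eqxx.
have compE (r : nat) (b : {ffun 'I_n -> 'I_r.+1}) :
    compatible sigma b = chain d (extend b) r.
  apply/forallP/chainP => [||[_ bS] i]; first by rewrite sd ext_out.
    rewrite sd => cb; split=> [n0|i ni].
      by rewrite -[0%N]/(nat_of_ord (Ordinal n0)) ext_ord -ltnS.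
    rewrite -[i]/(nat_of_ord (Ordinal ni)) ext_ord dE.
    have [iSn|nSi] := ltnP i.+1 n; last first.
      rewrite ext_out // (_ : _ \in _ = false) //; apply/negbTE; rewrite inE.
      by apply/existsP => -[k /andP[/eqP /= ki _]]; have := ltn_ord k; lia.
    have /forallP/(_ (Ordinal iSn))/implyP/(_ (eqxx _)) := cb (Ordinal ni).
    by rewrite -(@descE (Ordinal ni) (Ordinal iSn)) // -(ext_ord b (Ordinal iSn)).
  apply/forallP => j; apply/implyP => /eqP ji; rewrite sd in bS.
  by have := bS i (ltn_ord i); rewrite -ji !ext_ord dE (descE i j).
have sumE (r : nat) :
    \sum_(b : {ffun 'I_n -> 'I_r.+1} | compatible sigma b) q ^+ (\sum_i b i)
    = chain_sum q d r.
  by rewrite -(sum_chain q sd (leqnn r)); apply: eq_bigl => b; apply: compE.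
under eq_bigr do rewrite sumE.
have [h] := chain_series q d N (ex_intro (fun c => t = t * c) 1 (esym (mulr1 t))).
rewrite sd => ->; exists h; congr (_ + _).
have -> : des sigma = (\sum_(i : 'I_n) if i \in descents sigma then 1 else 0)%N.
  by rewrite /des -sum1_card big_mkcond.
have -> : maj sigma = (\sum_(i : 'I_n) if i \in descents sigma then i.+1 else 0)%N.
  by rewrite /maj big_mkcond.
rewrite !expr_sum -big_split /=.
apply: eq_bigr => i _; rewrite dE; case: (i \in _); last by rewrite !expr0 mulr1.
by rewrite !expr1.
Qed.

(** * Power series in five variables *)

Lemma big_ord_stop (V : nmodType) (G : nat -> V) k j : (k <= j)%N ->
  (forall a, (k <= a)%N -> G a = 0) -> \sum_(a < j) G a = \sum_(a < k) G a.
Proof.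
move=> kj G0; rewrite -(subnKC kj); elim: (j - k)%N => [|d IH]; first by rewrite addn0.
by rewrite addnS big_ord_recr /= IH G0 ?leq_addr // addr0.
Qed.

Lemma big_ord_only (V : nmodType) (G : nat -> V) i j : (i < j)%N ->
  (forall a, a != i -> G a = 0) -> \sum_(a < j) G a = G i.
Proof.
move=> ij G0; rewrite (bigD1 (Ordinal ij)) //= big1 ?addr0 // => a ai.
exact: G0.
Qed.

Section Monomials.
Variables (n : nat) (R : comNzRingType).
Implicit Types (k l m : 'X_{1..n}) (h : mpseries n R) (i : 'I_n).

Definition psmono k : mpseries n R := MPSeries (fun m => (m == k)%:R).

Lemma pscoef_monoM k h m :
  pscoef (psmono k * h) m = if (k <= m)%MM then pscoef h (m - k)%MM else 0.
Proof.
rewrite pscoefM; case: ifP => km; last first.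
  rewrite big1 // => l lm; rewrite /=; case: eqP => [e|_]; last by rewrite mul0r.
  by rewrite e km in lm.
have kd : (mdeg k < (mdeg m).+1)%N.
  by rewrite ltnS -[in leqRHS](submK km) mdegD leq_addl.
rewrite (bigD1 (BMultinom kd)) //= eqxx mul1r big1 ?addr0 // => l /andP[_].
by rewrite bmeqP /= => /negbTE ->; rewrite mul0r.
Qed.

Lemma psmonoD k l : psmono k * psmono l = psmono (k + l)%MM.
Proof.
apply: mpseriesP => m; rewrite pscoef_monoM /=; case: ifP => km.
  congr (_%:R); congr nat_of_bool; apply/eqP/eqP => [<-|->]; first by rewrite addmC submK.
  by rewrite addmC addmK.
case: eqP => // e; move: km; rewrite e => /negbT /negP []; apply/mnm_lepP => i.
by rewrite mnmDE leq_addr.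
Qed.

Lemma psmono0 : psmono 0%MM = 1.
Proof. by apply: mpseriesP => m; rewrite pscoef1. Qed.

Lemma psXE i j : psX R i ^+ j = psmono (U_(i) *+ j).
Proof.
elim: j => [|j IH]; first by rewrite expr0 mulm0n psmono0.
by rewrite exprS IH mulmS -psmonoD.
Qed.

Lemma pscoef_XnM i j h m :
  pscoef (psX R i ^+ j * h) m =
  if (j <= m i)%N then pscoef h (m - U_(i) *+ j)%MM else 0.
Proof.
rewrite psXE pscoef_monoM; congr (if _ then _ else _).
apply/mnm_lepP/idP => [/(_ i)|ji i']; first by rewrite mulmnE mnm1E eqxx mul1n.
by rewrite mulmnE mnm1E; case: eqP => [<-|_]; rewrite ?mul1n.
Qed.

Lemma modeq_pscoef i N (f g : mpseries n R) m :
  modeq (psX R i) N f g -> (m i < N)%N -> pscoef f m = pscoef g m.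
Proof.
by move=> [h ->] mN; rewrite pscoefD pscoef_XnM leqNgt mN addr0.
Qed.

Lemma pscoefMz h (c : int) m : pscoef (h *~ c) m = pscoef h m *~ c.
Proof.
have Mn j : pscoef (h *+ j) m = pscoef h m *+ j.
  elim: j => [|j IH]; first by rewrite !mulr0n /= if_same.
  by rewrite !mulrS pscoefD IH.
by case: c => j; rewrite ?NegzE ?mulrNz ?pscoefN -!pmulrn Mn.
Qed.

Lemma pscoef_sum I (r : seq I) (P : pred I) (F : I -> mpseries n R) m :
  pscoef (\sum_(a <- r | P a) F a) m = \sum_(a <- r | P a) pscoef (F a) m.
Proof.
elim/big_rec2: _ => [|a x f _ <- //]; first by rewrite /= if_same.
Qed.

Lemma ps_sums_unique F (S S' : mpseries n R) :
  ps_sums F S -> ps_sums F S' -> S = S'.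
Proof.
move=> FS FS'; apply: mpseriesP => m; have [N H] := FS m; have [N' H'] := FS' m.
by rewrite -(H (maxn N N')) ?leq_maxl // -(H' (maxn N N')) ?leq_maxr.
Qed.

(** Sums a series whose terms are expanded in a second variable; only finitely many index pairs
    reach a given monomial, so the limit is a double sum whose order can be exchanged. *)
Lemma ps_sums_double i1 i2 (F : nat -> mpseries n R) (c : nat -> nat -> mpseries n R) :
  (forall a N, modeq (psX R i2) N (F a) (\sum_(b < N) psX R i2 ^+ b * c a b)) ->
  ps_sums (fun a => psX R i1 ^+ a * F a)
    (MPSeries (fun m => \sum_(a < (m i1).+1) \sum_(b < (m i2).+1)
        pscoef (psX R i1 ^+ a * (psX R i2 ^+ b * c a b)) m)).
Proof.
move=> Fc m; exists (m i1).+1 => j mj; rewrite pscoef_sum.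
rewrite -[RHS]/(\sum_(a < (m i1).+1) \sum_(b < (m i2).+1)
  pscoef (psX R i1 ^+ a * (psX R i2 ^+ b * c a b)) m).
rewrite (@big_ord_stop _ (fun a => pscoef (psX R i1 ^+ a * F a) m) _ _ mj); last first.
  by move=> a ma; rewrite pscoef_XnM leqNgt ma.
apply: eq_bigr => a _; rewrite -pscoef_sum -mulr_sumr.
apply: (@modeq_pscoef i2 (m i2).+1) => //.
exact/modeqMl/Fc.
Qed.

End Monomials.

(** * Existence and uniqueness of the solution of the defining identity *)

Lemma modeq0 (R : comNzRingType) (x a b : R) : modeq x 0 a b.
Proof. by exists (a - b); rewrite expr0 mul1r addrC subrK. Qed.

Lemma modeq_div (R : comUnitRingType) (x : R) N a b d :
  d \is a GRing.unit -> modeq x N (a * d) b -> modeq x N (b / d) a.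
Proof.
move=> du [h e]; exists (- h / d); apply/eqP.
by rewrite -(inj_eq (mulIr du)) mulrDl e divrK // -!mulrA mulVr // mulr1 mulrN addrK.
Qed.

Definition perm_poly (n : nat) : {mpoly int[4]} :=
  \sum_(sigma : 'S_n)
     s_ ^+ exc sigma * t_ ^+ des sigma * q_ ^+ maj sigma * Y_ ^+ fix_ sigma.

Lemma ps_of_mpolyX (i : 'I_4) :
  [:: ps_s; ps_t; ps_q; ps_Y]`_i = psX int (widen_ord (leqnSn 4) i).
Proof.
case: i => -[|[|[|[|]]]] //= i4; rewrite /ps_s /ps_t /ps_q /ps_Y;
by congr psX; apply: val_inj.
Qed.

HB.instance Definition _ := GRing.RMorphism.copy ps_of_mpoly
  (mmap intr (fun i : 'I_4 => [:: ps_s; ps_t; ps_q; ps_Y]`_i)).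

(** Recovers a polynomial from its image, at the monomials free of [u]. *)
Lemma pscoef_of_mpoly p (m : 'X_{1..4}) :
  pscoef (ps_of_mpoly p) (mnmwiden m) = p@_m.
Proof.
rewrite /ps_of_mpoly /mmap pscoef_sum [in RHS](mpolyE p) raddf_sum.
apply: eq_bigr => k _; rewrite [RHS]mcoeffZ mcoeffX.
have -> : mmap1 (fun i : 'I_4 => [:: ps_s; ps_t; ps_q; ps_Y]`_i) k =
    psmono int (mnmwiden k).
  rewrite /mmap1 (eq_bigr (fun i =>
    psmono int (U_(widen_ord (leqnSn 4) i) *+ k i)%MM)) => [|i _]; last first.
    by rewrite ps_of_mpolyX psXE.
  rewrite -(big_morph _ (fun k l => esym (psmonoD int k l)) (@psmono0 5 int)); congr psmono.
  rewrite [in RHS](multinomUE_id k) mnmwiden_sum; apply: eq_bigr => i _.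
  elim: (k i) => [|j IH]; first by rewrite !mulm0n mnmwiden0.
  by rewrite !mulmS mnmwidenD -IH mnmwiden1.
rewrite -[X in pscoef X _]/((p@_k)%:~R * psmono int (mnmwiden k)).
rewrite mulrzl pscoefMz mulrzz mulrC [pscoef _ _]/=; congr (_ * _%:R).
by rewrite (inj_eq (@inj_mnmwiden _)) eq_sym.
Qed.

Lemma ps_of_mpoly_gen :
  [/\ ps_of_mpoly s_ = ps_s, ps_of_mpoly t_ = ps_t, ps_of_mpoly q_ = ps_q
    & ps_of_mpoly Y_ = ps_Y].
Proof.
by rewrite /ps_of_mpoly /s_ /t_ /q_ /Y_; split; rewrite mmapX mmap1U.
Qed.

Definition colour_ps (r n : nat) : Zps := colour_sum ps_s ps_q ps_Y r n.

Lemma lhs_series r N :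
  modeq ps_u N ((1 - ps_q * ps_s) * qpoch ps_u ps_q r
      * qpoch (ps_u * ps_s * ps_q) ps_q r / lhs_den r)
    (\sum_(n < N) ps_u ^+ n * colour_ps r n).
Proof.
case: N => [|N]; first exact: modeq0.
exact: modeq_div (lhs_den_unit r) (colour_series ps_u ps_s ps_q ps_Y r (ltn0Sn N)).
Qed.

Lemma rhs_series n N :
  modeq ps_t N (ps_of_mpoly (perm_poly n) / qpoch ps_t ps_q n.+1)
    (\sum_(r < N) ps_t ^+ r * colour_ps r n).
Proof.
apply: modeq_div (rhs_den_unit _) _.
have [es et eq eY] := ps_of_mpoly_gen.
pose w (sigma : 'S_n) := ps_s ^+ exc sigma * ps_Y ^+ fix_ sigma.
have -> : ps_of_mpoly (perm_poly n) =
    \sum_(sigma : 'S_n) w sigma * (ps_t ^+ des sigma * ps_q ^+ maj sigma).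
  rewrite /perm_poly rmorph_sum /=; apply: eq_bigr => sigma _.
  by rewrite !rmorphM !rmorphXn /= es et eq eY /w; ring.
have -> : \sum_(r < N) ps_t ^+ r * colour_ps r n =
   \sum_(sigma : 'S_n) w sigma * (\sum_(r < N) ps_t ^+ r *
      \sum_(b : {ffun 'I_n -> 'I_r.+1} | compatible sigma b) ps_q ^+ (\sum_i b i)).
  under eq_bigr do rewrite mulr_sumr.
  rewrite exchange_big /=; apply: eq_bigr => sigma _.
  rewrite mulr_sumr; apply: eq_bigr => r _.
  rewrite mulrCA; congr (_ * _); rewrite mulr_sumr; apply: eq_bigr => b _.
  by rewrite /w; ring.
rewrite mulr_suml.
elim/big_rec2: _ => [|sigma x y _ IH]; first exact: modeq_refl.
have [h1 ->] := IH.
have [h2 e2] := macmahon ps_t ps_q sigma N.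
by exists (w sigma * h2 + h1); rewrite -mulrA e2; ring.
Qed.

(** Both sides expand the double series with coefficient [colour_ps r n] at [t^r u^n], summed in
    opposite orders. *)
Lemma perm_poly_identity : defining_identity perm_poly.
Proof.
pose it := @Ordinal 5 1 isT; pose iu := @Ordinal 5 4 isT.
exists (MPSeries (fun m => \sum_(a < (m it).+1) \sum_(b < (m iu).+1)
        pscoef (ps_t ^+ a * (ps_u ^+ b * colour_ps a b)) m)).
  exact: (@ps_sums_double _ _ it iu) lhs_series.
have := @ps_sums_double _ _ iu it _ (fun n r => colour_ps r n) rhs_series.
set S1 := MPSeries _; set S2 := MPSeries _.
have -> : S1 = S2.
  apply: mpseriesP => m; apply: etrans (exchange_big _ _ _ _ _ _) _.
  apply: eq_bigr => a _.
  by apply: eq_bigr => b _; rewrite mulrCA.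
move=> H m; have [N HN] := H m; exists N => j jN; rewrite -(HN j jN).
congr (pscoef _ m); apply: eq_bigr => a _.
by rewrite /rhs_term mulrCA.
Qed.

(** Strong induction on the power of [u]: earlier differences vanish and later terms carry a higher
    power, which isolates [D n] at the monomials free of [u]. *)
Lemma defining_identity_unique A A' :
  defining_identity A -> defining_identity A' -> forall n, A n = A' n.
Proof.
move=> [S lS rS] [S' lS' rS']; rewrite -(ps_sums_unique lS lS') in rS' => {lS lS' S'}.
pose iu := @Ordinal 5 4 isT.
pose D n := ps_of_mpoly (A n - A' n) / qpoch ps_t ps_q n.+1.
have D0 (m : 'X_{1..5}) : exists N, forall j, (N <= j)%N ->
    pscoef (\sum_(n < j) ps_u ^+ n * D n) m = 0.
  have [N H] := rS m; have [N' H'] := rS' m; exists (maxn N N') => j.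
  rewrite geq_max => /andP[/H e /H' e'].
  rewrite (eq_bigr (fun n : 'I_j => rhs_term A n - rhs_term A' n)) => [|n _].
    by rewrite sumrB pscoefD pscoefN e e' subrr.
  by rewrite /rhs_term /D rmorphB; ring.
elim/ltn_ind => n IH; apply/eqP; rewrite -subr_eq0; apply/eqP.
have Dlow (m : 'X_{1..5}) : m iu = 0%N -> pscoef (D n) m = 0.
  move=> mu; have [N /(_ (maxn N n.+1) (leq_maxl _ _))] := D0 (m + U_(iu) *+ n)%MM.
  have mnu : (m + U_(iu) *+ n)%MM iu = n by rewrite mnmDE mulmnE mnm1E eqxx mul1n mu.
  have jn := leq_maxr N n.+1.
  rewrite pscoef_sum (@big_ord_only _ (fun k => pscoef (ps_u ^+ k * D k) _) _ _ jn).
    by rewrite pscoef_XnM mnu leqnn addmK.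
  move=> k kn; rewrite pscoef_XnM mnu; case: leqP => // kn'.
  by rewrite /D IH ?ltn_neqAle ?kn // subrr rmorph0 mul0r /= if_same.
apply/mpolyP => m; rewrite mcoeff0 -pscoef_of_mpoly.
have -> : ps_of_mpoly (A n - A' n) = D n * qpoch ps_t ps_q n.+1.
  by rewrite /D divrK // rhs_den_unit.
rewrite pscoefM big1 // => k km; rewrite Dlow ?mul0r //.
have /mnm_lepP /(_ ord_max) := km; rewrite mnmwiden_ordmax leqn0 => /eqP k0.
by rewrite (_ : iu = ord_max) //; apply: val_inj.
Qed.

Theorem theorem1p1 (A : nat -> {mpoly int[4]}) :
  defining_identity A <->
  forall n : nat,
    \sum_(sigma : 'S_n)
       s_ ^+ exc sigma * t_ ^+ des sigma * q_ ^+ maj sigma * Y_ ^+ fix_ sigma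
    = A n.
Proof.
(* One direction is uniqueness; the other transfers the identity from [perm_poly] to [A] term by
   term. *)
split=> [HA n|HA]; first exact: (defining_identity_unique perm_poly_identity HA).
have [S lS rS] := perm_poly_identity; exists S => // m.
have [N HN] := rS m; exists N => j jN; rewrite -(HN j jN).
by congr (pscoef _ m); apply: eq_bigr => n _; rewrite /rhs_term -HA.
Qed.
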